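(* Let $n\ge1$. The Webster scalar curvature functions of contact forms conformal to $\theta_0$ on $\mathbb{S}^{2n+1}$ are dense in $C^0(\mathbb{S}^{2n+1})$ among bounded functions which are positive somewhere. That is: for every $\bar R\in C^0(\mathbb{S}^{2n+1})$ (automatically bounded) with $\bar R(q)>0$ for some $q\in\mathbb{S}^{2n+1}$, and every $\varepsilon>0$, there exist a function $\bar R'\in C^0(\mathbb{S}^{2n+1})$ with $\|\bar R'-\bar R\|_{C^0(\mathbb{S}^{2n+1})}<\varepsilon$ and a smooth function $v>0$ on $\mathbb{S}^{2n+1}$ such that $\bar R'$ is the Webster scalar curvature of the contact form $v^{2/n}\theta_0$.
   Context: $\mathbb{S}^{2n+1}$ is the unit sphere of $\mathbb{C}^{n+1}$ with its standard CR structure and standard contact form $\theta_0=\sqrt{-1}\sum_{j=1}^{n+1}(\zeta_j\,d\bar\zeta_j-\bar\zeta_j\,d\zeta_j)$. A contact form conformal to $\theta_0$ is one of the form $\theta=v^{2/n}\theta_0$ with $v>0$. The Webster (pseudohermitian) scalar curvature of $\theta=v^{2/n}\theta_0$ is $$\operatorname{Scal}_\theta=v^{-\frac{n+2}{n}}\Big(-\frac{2(n+1)}{n}\Delta_{\theta_0}v+\frac{n(n+1)}{2}v\Big),$$ where $$\Delta_{\theta_0}=\sum_{j=1}^{n+1}\frac{\partial^2}{\partial\zeta_j\partial\bar\zeta_j}-\sum_{j,k=1}^{n+1}\zeta_j\bar\zeta_k\frac{\partial^2}{\partial\zeta_j\partial\bar\zeta_k}-\frac n2\sum_{k=1}^{n+1}\Big(\zeta_k\frac{\partial}{\partial\zeta_k}+\bar\zeta_k\frac{\partial}{\partial\bar\zeta_k}\Big).$$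 Equivalently, $\operatorname{Scal}_\theta=\bar R'$ means $-\Delta_{\theta_0}v+\frac{n^2}{4}v=\frac{n}{2(n+1)}\bar R'v^{1+\frac2n}$ on $\mathbb{S}^{2n+1}$. *)

(* Defs.v *)
From HB Require Import structures.
From mathcomp Require Export all_boot all_order all_algebra.
From mathcomp Require Export all_classical all_reals all_analysis.
From mathcomp.real_closed Require Export complex.

Set Implicit Arguments.
Unset Strict Implicit.
Unset Printing Implicit Defensive.

Export Order.TTheory GRing.Theory Num.Theory.
Export numFieldNormedType.Exports.

Local Open Scope classical_set_scope.
Local Open Scope complex_scope.
Local Open Scope ring_scope.

(* C^m seen as the real normed space R^m x R^m: the pair (x, y) stands for the
   vector x + iy.  Real directional derivatives 'D_v are thus the library's. *)
Notation Cspace R m := ('rV[R]_m * 'rV[R]_m)%type (only parsing).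

Definition zeta (R : realType) (m : nat) (j : 'I_m) (p : Cspace R m) : R[i] :=
  p.1 ord0 j +i* p.2 ord0 j.

Definition ex (R : realType) (m : nat) (j : 'I_m) : Cspace R m :=
  (delta_mx ord0 j, 0).

Definition ey (R : realType) (m : nat) (j : 'I_m) : Cspace R m :=
  (0, delta_mx ord0 j).

(* S^{2n+1}, the unit sphere of C^{n+1} *)
Definition sphere (R : realType) (n : nat) : set (Cspace R n.+1) :=
  [set p : Cspace R n.+1 | \sum_(j < n.+1) (p.1 ord0 j ^+ 2 + p.2 ord0 j ^+ 2) = 1].

Arguments sphere : clear implicits.

(* The norm of C^0(S^{2n+1}), as an extended real. *)
Definition C0norm (R : realType) (n : nat) (f : Cspace R n.+1 -> R) : \bar R :=
  ereal_sup [set (`|f p|)%:E | p in sphere R n].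

Fixpoint Ck_on (R : realType) (m k : nat) (U : set (Cspace R m))
    (f : Cspace R m -> R) : Prop :=
  match k with
  | 0%N => forall p, U p -> {for p, continuous f}
  | k'.+1 => (forall p, U p -> {for p, continuous f}) /\
      forall j : 'I_m,
        [/\ (forall p, U p -> derivable f p (ex R j)),
            (forall p, U p -> derivable f p (ey R j)),
            Ck_on k' U ('D_(ex R j) f) & Ck_on k' U ('D_(ey R j) f)]
  end.

Definition smooth_on (R : realType) (m : nat) (U : set (Cspace R m))
    (f : Cspace R m -> R) : Prop :=
  forall k : nat, Ck_on k U f.

(* V is a smooth function on a neighborhood of the sphere which extends v;
   only the values of v on the sphere matter. *)
Definition smooth_extension (R : realType) (n : nat)
    (v V : Cspace R n.+1 -> R) : Prop :=
  exists U : set (Cspace R n.+1),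
    [/\ open U, sphere R n `<=` U, smooth_on U V &
        forall p, sphere R n p -> V p = v p].

Definition smooth_on_sphere (R : realType) (n : nat)
    (v : Cspace R n.+1 -> R) : Prop :=
  exists V, smooth_extension v V.

Definition cderive (R : realType) (m : nat) (e : Cspace R m)
    (F : Cspace R m -> R[i]) (p : Cspace R m) : R[i] :=
  'D_e (fun q => complex.Re (F q)) p +i* 'D_e (fun q => complex.Im (F q)) p.

(* The Wirtinger derivatives d/dzeta_j and d/d(conj zeta_j). *)
Definition dz (R : realType) (m : nat) (j : 'I_m)
    (F : Cspace R m -> R[i]) (p : Cspace R m) : R[i] :=
  2^-1 * (cderive (ex R j) F p - (0 +i* 1) * cderive (ey R j) F p).

Definition dzbar (R : realType) (m : nat) (j : 'I_m)
    (F : Cspace R m -> R[i]) (p : Cspace R m) : R[i] :=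
  2^-1 * (cderive (ex R j) F p + (0 +i* 1) * cderive (ey R j) F p).

Definition sublaplacian (R : realType) (n : nat)
    (F : Cspace R n.+1 -> R[i]) (p : Cspace R n.+1) : R[i] :=
  \sum_(j < n.+1) dz j (dzbar j F) p
  - \sum_(j < n.+1) \sum_(k < n.+1)
      zeta j p * conjc (zeta k p) * dz j (dzbar k F) p
  - n%:R / 2 *
    \sum_(k < n.+1) (zeta k p * dz k F p + conjc (zeta k p) * dzbar k F p).

(* Scal_theta for theta = V^{2/n} theta_0, as a complex number whose imaginary
   part vanishes when V is real-valued and twice continuously differentiable. *)
Definition webster_scal (R : realType) (n : nat)
    (V : Cspace R n.+1 -> R) (p : Cspace R n.+1) : R[i] :=
  ((V p) `^ (- ((n%:R + 2) / n%:R)))%:C *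
  (- (2 * (n%:R + 1) / n%:R) * sublaplacian (fun q => (V q)%:C) p
   + n%:R * (n%:R + 1) / 2 * (V p)%:C).

(* K is the Webster scalar curvature of v^{2/n} theta_0 on S^{2n+1}.  The
   operator [sublaplacian] is tangential along the sphere: it annihilates there
   (|zeta|^2 - 1) W for every smooth W.  Hence the values of [webster_scal V] on
   the sphere do not depend on the choice of the smooth extension V of v. *)
Definition is_webster_scalar_curvature (R : realType) (n : nat)
    (v K : Cspace R n.+1 -> R) : Prop :=
  exists2 V, smooth_extension v V &
    forall p, sphere R n p -> (K p)%:C = webster_scal V p.

(* Main.v *)
From HB Require Import structures.
Require Import Defs.
From mathcomp Require Import finmap ring lra.

Set Implicit Arguments.
Unset Strict Implicit.
Unset Printing Implicit Defensive.

Local Open Scope classical_set_scope.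
Local Open Scope ring_scope.

(** Let L = n^2/4 - Delta be the conformal sublaplacian: the curvature of
    v^(2/n) theta_0 is 2(n+1)/n * v^(-(n+2)/n) * L v.  Fix a point q of the
    sphere with Rbar q > 0.  The theorem holds because a highly concentrated
    bubble turns the equation L v = K v^(1+2/n) into an almost linear one.

    For 0 <= a < 1 put Q p = |1 - a <p, q>|^2.  The bubble U = Q^(-n/2) satisfies
    L U = n^2/4 (1 - a^2) U^(1+2/n) on the sphere [bubble_equation], hence has
    constant curvature, which a scaling makes equal to Rbar q.  Replace Rbar by
    a function K0 that is uniformly close to it and is equal to Rbar q near q
    [soft_localized], set beta = n^2/4 (1 - a^2) / Rbar q, and let w solve
    L w = beta (K0 - Rbar q) U^(1+2/n).  Then
    L (U + w) = beta K0 U^(1+2/n), so that the curvature of a suitable multiple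
    of U + w is K0 (1 + w/U)^(-(n+2)/n).  Where K0 differs from Rbar q the point
    stays away from q and U is bounded independently of a, so L w = O(1 - a^2),
    and w = O(1 - a^2) by the maximum principle [conf_lap_bound].  Since U is at
    least 2^(-n) on the whole sphere, w/U tends uniformly to 0 as a tends to 1,
    and the curvature becomes uniformly close to K0.

    The linear equation need only be solved approximately, which removes every
    question of regularity.  Its right hand side is a uniform limit of
    polynomials [weierstrass], and L is onto the restrictions to the sphere of
    the polynomials of bounded degree, a finite dimensional space that it
    preserves and on which it is injective by the maximum principle
    [conf_lap_surj].  Thus w is a polynomial, and an error e in L w changes the
    curvature by about e / (beta U^(1+2/n)), which is as small as desired because
    the polynomial approximation is chosen after a.

    All computations are made in real coordinates: on a real function, four
    times Delta at a point p of the sphere is the trace of the Hessian over the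
    complex orthogonal complement of p, minus 2n times the radial derivative
    [sublaplacian_real].  This is also the form to which the maximum principle
    applies. *)

(** * Real coordinates and partial derivatives *)

Notation dirs m := ('I_m + 'I_m)%type.

Definition crd (R : realType) (m : nat) (i : dirs m) (p : Cspace R m) : R :=
  match i with inl j => p.1 ord0 j | inr j => p.2 ord0 j end.

Definition bas (R : realType) (m : nat) (i : dirs m) : Cspace R m :=
  match i with inl j => ex R j | inr j => ey R j end.

Section Coordinates.
Variables (R : realType) (m : nat).
Implicit Types (p v : Cspace R m) (i j : dirs m).

Lemma crdD i p v : crd i (p + v) = crd i p + crd i v.
Proof. by case: i => j; rewrite /crd mxE. Qed.

Lemma crdZ i (a : R) p : crd i (a *: p) = a * crd i p.
Proof. by case: i => j; rewrite /crd mxE. Qed.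

Lemma crd_bas i j : crd i (bas R j) = (i == j)%:R.
Proof.
by case: i j => i [] j; rewrite /crd /bas /= mxE //= eqxx.
Qed.

Lemma crd_inj p v : (forall i, crd i p = crd i v) -> p = v.
Proof.
case: p v => [a b] [c d] h; congr pair; apply/rowP => j.
  exact: (h (inl j)).
exact: (h (inr j)).
Qed.

Lemma continuous_crd i : continuous (@crd R m i).
Proof.
case: i => j p.
  apply: (@continuous_comp _ _ _ fst (fun u : 'rV[R]_m => u ord0 j)).
    exact: cvg_fst.
  exact: coord_continuous.
apply: (@continuous_comp _ _ _ snd (fun u : 'rV[R]_m => u ord0 j)).
  exact: cvg_snd.
exact: coord_continuous.
Qed.

Lemma is_derive_linear_form (f : Cspace R m -> R) p v :
  (forall (h : R) v p, f (h *: v + p) = h * f v + f p) -> is_derive p v f (f v).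
Proof.
move=> fl; have h : (fun h : R => h^-1 *: (f (h *: v + p) - f p)) @ 0^' --> f v.
  apply: cvg_near_cst; near=> h.
  have h0 : h != 0 by near: h; exact: nbhs_dnbhs_neq.
  by rewrite fl addrK -[LHS]/(h^-1 * (h * f v)) mulrA mulVf// mul1r.
split; last exact: (cvg_lim _ h).
by apply/cvg_ex; exists (f v).
Unshelve. all: by end_near. Qed.

Lemma is_derive_crd i p v : is_derive p v (@crd R m i) (crd i v).
Proof. by apply: is_derive_linear_form => h u x; rewrite crdD crdZ. Qed.

End Coordinates.

(** Locked so that unification never unfolds the limit that defines a
    directional derivative. *)
HB.lock Definition partial (R : realType) (m : nat) (i : dirs m)
  (f : Cspace R m -> R) : Cspace R m -> R := 'D_(bas R i) f.

(** * Polynomials of bounded degree *)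

(** The polynomial functions of degree less than d, so that differentiation
    lowers d by one without exception, the zero function being the only one at
    d = 0.  Describing functions rather than formal polynomials makes evaluation
    trivial. *)
Inductive poly_lt (R : realType) (m : nat) : nat -> (Cspace R m -> R) -> Prop :=
| poly_lt0 d : poly_lt d (fun=> 0)
| poly_ltC d c : poly_lt d.+1 (fun=> c)
| poly_ltD d f g : poly_lt d f -> poly_lt d g -> poly_lt d (fun p => f p + g p)
| poly_ltX d i f : poly_lt d.+1 f -> poly_lt d.+2 (fun p => crd i p * f p).

Section Polynomials.
Variables (R : realType) (m : nat).
Implicit Types (f g : Cspace R m -> R) (p : Cspace R m) (d : nat) (i j : dirs m).

Lemma poly_lt_eq d f g : (forall p, f p = g p) -> poly_lt d f -> poly_lt d g.
Proof. by move=> /funext ->. Qed.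

Lemma poly_lt_widen d e f : (d <= e)%N -> poly_lt d f -> poly_lt e f.
Proof.
move=> de df; elim: df e de => {d f}.
- by move=> *; exact: poly_lt0.
- by move=> d c [//|e] _; exact: poly_ltC.
- by move=> d f g _ ihf _ ihg e de; apply: poly_ltD; [exact: ihf|exact: ihg].
- by move=> d i f _ ih [//|[//|e]] de; apply: poly_ltX; exact: ih.
Qed.

Lemma poly_lt0_eq0 d f : poly_lt d f -> d = 0%N -> f = fun=> 0.
Proof.
elim=> // {d f} d f g _ ihf _ ihg d0.
by rewrite ihf// ihg//; apply/funext => p; rewrite addr0.
Qed.

Lemma poly_lt_crd d i f : poly_lt d f -> poly_lt d.+1 (fun p => crd i p * f p).
Proof.
case: d => [/poly_lt0_eq0 ->//|d]; last exact: poly_ltX.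
by apply: poly_lt_eq (poly_lt0 _ _ _) => p; rewrite mulr0.
Qed.

Lemma poly_lt_scale d (c : R) f : poly_lt d f -> poly_lt d (fun p => c * f p).
Proof.
elim=> {d f}.
- by move=> d; apply: poly_lt_eq (poly_lt0 _ _ _) => p; rewrite mulr0.
- by move=> d c'; exact: poly_ltC.
- by move=> d f g _ ihf _ ihg; apply: poly_lt_eq (poly_ltD ihf ihg) => p; rewrite mulrDr.
- by move=> d i f _ ih; apply: poly_lt_eq (poly_ltX i ih) => p; rewrite mulrCA.
Qed.

Lemma poly_ltB d f g : poly_lt d f -> poly_lt d g -> poly_lt d (fun p => f p - g p).
Proof.
move=> df /(poly_lt_scale (-1)) dg; apply: poly_lt_eq (poly_ltD df dg) => p.
by rewrite mulN1r.
Qed.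

Lemma poly_lt_sum d (J : Type) (r : seq J) (f : J -> Cspace R m -> R) :
  (forall k, poly_lt d (f k)) -> poly_lt d (fun p => \sum_(k <- r) f k p).
Proof.
move=> df; elim: r => [|k r ih].
  by apply: poly_lt_eq (poly_lt0 _ _ _) => p; rewrite big_nil.
by apply: poly_lt_eq (poly_ltD (df k) ih) => p; rewrite big_cons.
Qed.

Lemma poly_ltM d e f g : poly_lt d f -> poly_lt e g ->
  poly_lt (d + e) (fun p => f p * g p).
Proof.
move=> df dg; elim: df => {d f}.
- by move=> d; apply: poly_lt_eq (poly_lt0 _ _ _) => p; rewrite mul0r.
- by move=> d c; apply: poly_lt_widen (poly_lt_scale c dg); rewrite leq_addl.
- by move=> d f h _ ihf _ ihh; apply: poly_lt_eq (poly_ltD ihf ihh) => p; rewrite mulrDl.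
- move=> d i f _ ih; rewrite addSn.
  by apply: poly_lt_eq (poly_lt_crd i ih) => p; rewrite mulrA.
Qed.

Lemma poly_lt_continuous d f : poly_lt d f -> continuous f.
Proof.
elim=> {d f} => [d|d c|d f g _ cf _ cg|d i f _ cf] p; try exact: cvg_cst.
  by apply: continuousD; [exact: cf|exact: cg].
by apply: continuousM; [exact: continuous_crd|exact: cf].
Qed.

Lemma is_derive_crdM j f i p (df : R) : is_derive p (bas R i) f df ->
  is_derive p (bas R i) (fun p => crd j p * f p) (crd j p * df + (j == i)%:R * f p).
Proof.
move=> hf; have h := is_deriveM (is_derive_crd j p (bas R i)) hf.
apply: (is_derive_eq h); rewrite crd_bas; congr (_ + _); exact: mulrC.
Qed.

Lemma poly_lt_derive d f : poly_lt d f ->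
  exists g : dirs m -> Cspace R m -> R, forall i,
    poly_lt d.-1 (g i) /\ forall p, is_derive p (bas R i) f (g i p).
Proof.
elim=> {d f}.
- move=> d; exists (fun=> fun=> 0) => i; split; first exact: poly_lt0.
  by move=> p; exact: is_derive_cst.
- move=> d c; exists (fun=> fun=> 0) => i; split; first exact: poly_lt0.
  by move=> p; exact: is_derive_cst.
- move=> d f g _ [f' hf] _ [g' hg]; exists (fun i p => f' i p + g' i p) => i.
  split; first by apply: poly_ltD; [exact: (hf i).1|exact: (hg i).1].
  by move=> p; exact: (is_deriveD ((hf i).2 p) ((hg i).2 p)).
- move=> d j f df [f' hf].
  exists (fun i p => crd j p * f' i p + (j == i)%:R * f p) => i; split.
    apply: poly_ltD; last exact: poly_lt_scale.
    by apply: poly_lt_crd; exact: (hf i).1.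
  by move=> p; apply: is_derive_crdM; exact: (hf i).2.
Qed.

Lemma partialE i f p : partial i f p = 'D_(bas R i) f p.
Proof. by rewrite partial.unlock. Qed.

Lemma poly_lt_partial d f i : poly_lt d f -> poly_lt d.-1 (partial i f).
Proof.
move=> /poly_lt_derive [g /(_ i)[dg h]]; apply: poly_lt_eq dg => p.
by rewrite partial.unlock; have [_ ->] := h p.
Qed.

Lemma poly_lt_is_derive d f i p : poly_lt d f ->
  is_derive p (bas R i) f (partial i f p).
Proof. by move=> /poly_lt_derive [g /(_ i)[dg h]]; rewrite partial.unlock; apply/derivableP; have [] := h p. Qed.

Lemma partial_cst i (c : R) : partial i (fun=> c) = (fun=> 0) :> (Cspace R m -> R).
Proof. by apply/funext => q; rewrite partial.unlock; exact: derive_cst. Qed.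

Lemma poly_lt_partialD d f g i : poly_lt d f -> poly_lt d g ->
  partial i (fun p => f p + g p) = fun p => partial i f p + partial i g p.
Proof.
move=> df dg; apply/funext => p; rewrite [LHS]partialE.
by have [_] := is_deriveD (poly_lt_is_derive i p df) (poly_lt_is_derive i p dg).
Qed.

Lemma poly_lt_partialX d f i j : poly_lt d f ->
  partial i (fun p => crd j p * f p) =
  fun p => crd j p * partial i f p + (j == i)%:R * f p.
Proof.
move=> df; apply/funext => p; rewrite [LHS]partialE.
by have [_] := is_derive_crdM j (poly_lt_is_derive i p df).
Qed.

Lemma poly_lt_partialZ d f i (c : R) : poly_lt d f ->
  partial i (fun p => c * f p) = fun p => c * partial i f p.
Proof.
move=> df; apply/funext => p; rewrite [LHS]partialE.
by have [_] := is_deriveZ c (poly_lt_is_derive i p df).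
Qed.

Lemma poly_lt_partialDC d f i j : poly_lt d f ->
  partial i (partial j f) = partial j (partial i f).
Proof.
have w (k : dirs m) (u : Cspace R m -> R) e : poly_lt e u -> poly_lt e (partial k u).
  by move=> /(poly_lt_partial k); apply: poly_lt_widen; exact: leq_pred.
elim=> {d f}.
- by move=> d; rewrite !partial_cst.
- by move=> d c; rewrite !partial_cst.
- move=> d f g df ihf dg ihg.
  rewrite (poly_lt_partialD j df dg) (poly_lt_partialD i df dg).
  rewrite (poly_lt_partialD i (w j _ _ df) (w j _ _ dg)).
  by rewrite (poly_lt_partialD j (w i _ _ df) (w i _ _ dg)) ihf ihg.
- move=> d k f df ih.
  have e u v : partial u (fun p => crd k p * partial v f p + (k == v)%:R * f p) =
      fun p => crd k p * partial u (partial v f) p + (k == u)%:R * partial v f p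
               + (k == v)%:R * partial u f p.
    rewrite (@poly_lt_partialD d.+2); first by rewrite (poly_lt_partialX _ _ (w v _ _ df)) (poly_lt_partialZ _ _ df).
      by apply: poly_lt_crd; exact: w.
    by apply: poly_lt_scale; exact: poly_lt_widen df.
  by rewrite !(poly_lt_partialX _ _ df) !e ih; apply/funext => p; rewrite addrAC.
Qed.

End Polynomials.

(** * The sublaplacian of a real function *)

(** Multiplication by the imaginary unit. *)
Definition rot (R : realType) (m : nat) (p : Cspace R m) : Cspace R m := (- p.2, p.1).

(** [crd i p * crd j p + crd i (rot p) * crd j (rot p)] is the matrix of the
    orthogonal projection onto the complex line of a unit vector p. *)
Definition sublap (R : realType) (n : nat) (V : Cspace R n.+1 -> R) (p : Cspace R n.+1) : R :=
  4^-1 * (\sum_i partial i (partial i V) p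
   - \sum_i \sum_j (crd i p * crd j p + crd i (rot p) * crd j (rot p)) *
       partial i (partial j V) p
   - 2 * n%:R * \sum_i crd i p * partial i V p).

Section SubLaplacian.
Local Open Scope complex_scope.
Variables (R : realType).

Lemma complexM (a b c d : R) : (a +i* b) * (c +i* d) = (a * c - b * d) +i* (a * d + b * c).
Proof. by []. Qed.

Lemma sum_complex (J : finType) (a b : J -> R) :
  \sum_j (a j +i* b j) = (\sum_j a j) +i* (\sum_j b j).
Proof.
by apply: (big_ind3 (fun u v w => u = v +i* w)) => // ? ? ? ? ? ? -> ->.
Qed.

Lemma half_complex : 2^-1 = (2^-1 +i* 0) :> R[i].
Proof. by rewrite -[RHS]/((2^-1)%:C) fmorphV rmorph_nat. Qed.

Lemma sum_dirs (m : nat) (F : dirs m -> R) : \sum_i F i = \sum_j (F (inl j) + F (inr j)).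
Proof. by rewrite big_sumType big_split. Qed.

Lemma cderive_real (m : nat) (V : Cspace R m -> R) (i : dirs m) (q : Cspace R m) :
  cderive (bas R i) (fun q => (V q)%:C) q = partial i V q +i* 0.
Proof.
rewrite partialE /cderive; congr (_ +i* _); exact: derive_cst.
Qed.

Lemma dzE (m : nat) (F : Cspace R m -> R[i]) (k : 'I_m) (q : Cspace R m) :
  dz k F q = 2^-1 *
    (cderive (bas R (inl k)) F q - (0 +i* 1) * cderive (bas R (inr k)) F q).
Proof. by []. Qed.

Lemma dzbar_real (m : nat) (V : Cspace R m -> R) (k : 'I_m) :
  dzbar k (fun q => (V q)%:C) =
  fun q => (2^-1 * partial (inl k) V q) +i* (2^-1 * partial (inr k) V q).
Proof.
apply/funext => q; rewrite /dzbar.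
rewrite -[ex R k]/(bas R (inl k)) -[ey R k]/(bas R (inr k)) !cderive_real half_complex.
by rewrite !complexM; congr (_ +i* _); ring.
Qed.

Lemma dz_real (m : nat) (V : Cspace R m -> R) (k : 'I_m) (q : Cspace R m) :
  dz k (fun q => (V q)%:C) q =
  (2^-1 * partial (inl k) V q) +i* (- (2^-1 * partial (inr k) V q)).
Proof.
rewrite dzE !cderive_real half_complex.
by rewrite !complexM; congr (_ +i* _); ring.
Qed.

Lemma dz_dzbar_real (m : nat) (V : Cspace R m -> R) (j k : 'I_m) (q : Cspace R m) :
  (forall i i', derivable (partial i V) q (bas R i')) ->
  dz j (dzbar k (fun q => (V q)%:C)) q =
  (4^-1 * (partial (inl j) (partial (inl k) V) q + partial (inr j) (partial (inr k) V) q)) +i*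
  (4^-1 * (partial (inl j) (partial (inr k) V) q - partial (inr j) (partial (inl k) V) q)).
Proof.
move=> dV; rewrite dzbar_real dzE.
have e i : cderive (bas R i) (fun q => (2^-1 * partial (inl k) V q) +i*
      (2^-1 * partial (inr k) V q)) q =
    (2^-1 * partial i (partial (inl k) V) q) +i* (2^-1 * partial i (partial (inr k) V) q).
  have e i' : 'D_(bas R i) (fun q => 2^-1 * partial i' V q) q
      = 2^-1 * partial i (partial i' V) q.
    rewrite [partial i (partial i' V) q]partialE; have /derivableP h := dV i' i.
    by have [_] := is_deriveZ (2^-1 : R) h.
  by rewrite /cderive; congr (_ +i* _); exact: e.
rewrite !e half_complex !complexM; congr (_ +i* _); lra.
Qed.

(** The mixed terms of the complex operator pair the Hermitian matrix
    zeta_j * conj zeta_k with the Hermitian matrix of second derivatives.  The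
    imaginary part of the product is antisymmetric in j and k because the real
    Hessian is symmetric, so it disappears from the sum. *)
Lemma sublaplacian_real (n : nat) (V : Cspace R n.+1 -> R) (p : Cspace R n.+1) :
  (forall i j, derivable (partial i V) p (bas R j)) ->
  (forall i j, partial i (partial j V) p = partial j (partial i V) p) ->
  sublaplacian (fun q => (V q)%:C) p = (sublap V p)%:C.
Proof.
move=> dV sV; rewrite /sublaplacian.
under eq_bigr do rewrite dz_dzbar_real//.
rewrite sum_complex.
pose a (j k : 'I_n.+1) := (p.1 ord0 j * p.1 ord0 k + p.2 ord0 j * p.2 ord0 k).
pose b (j k : 'I_n.+1) := (p.2 ord0 j * p.1 ord0 k - p.1 ord0 j * p.2 ord0 k).
pose c (j k : 'I_n.+1) := 4^-1 *
  (partial (inl j) (partial (inl k) V) p + partial (inr j) (partial (inr k) V) p).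
pose d (j k : 'I_n.+1) := 4^-1 *
  (partial (inl j) (partial (inr k) V) p - partial (inr j) (partial (inl k) V) p).
have -> : \sum_(j < n.+1) \sum_(k < n.+1)
      zeta j p * conjc (zeta k p) * dz j (dzbar k (fun q => (V q)%:C)) p =
   (\sum_j \sum_k (a j k * c j k - b j k * d j k)) +i*
   (\sum_j \sum_k (a j k * d j k + b j k * c j k)).
  rewrite -sum_complex; apply: eq_bigr => j _; rewrite -sum_complex.
  apply: eq_bigr => k _; rewrite dz_dzbar_real// /zeta /= !complexM.
  by rewrite /a /b /c /d; congr (_ +i* _); ring.
have -> : \sum_j \sum_k (a j k * d j k + b j k * c j k) = 0.
  set s := (LHS); suff : s = - s by move=> ?; lra.
  rewrite {1}/s exchange_big -sumrN; apply: eq_bigr => j _; rewrite -sumrN.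
  apply: eq_bigr => k _; rewrite /a /b /c /d.
  rewrite (sV (inl k) (inr j)) (sV (inr k) (inl j)) (sV (inl k) (inl j)) (sV (inr k) (inr j)).
  ring.
have -> : \sum_(j < n.+1) 4^-1 * (partial (inl j) (partial (inr j) V) p
    - partial (inr j) (partial (inl j) V) p) = 0.
  by rewrite big1// => j _; rewrite sV subrr mulr0.
have -> : \sum_(k < n.+1) (zeta k p * dz k (fun q => (V q)%:C) p
     + conjc (zeta k p) * dzbar k (fun q => (V q)%:C) p) =
   (\sum_i crd i p * partial i V p) +i* 0.
  rewrite sum_dirs; transitivity (\sum_(k < n.+1) ((crd (inl k) p * partial (inl k) V p +
      crd (inr k) p * partial (inr k) V p) +i* 0)); last by rewrite sum_complex big1_eq.
  apply: eq_bigr => k _.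
  rewrite dz_real dzbar_real /zeta /= !complexM.
  by congr (_ +i* _); lra.
have -> : n%:R / 2 = (n%:R / 2) +i* 0 :> R[i].
  by rewrite half_complex -(rmorph_nat (real_complex R)) complexM; congr (_ +i* _); ring.
rewrite ?complexM; congr (_ +i* _); last by ring.
rewrite /sublap -mulr_sumr sum_dirs.
have -> : \sum_j \sum_k (a j k * c j k - b j k * d j k) = 4^-1 *
  \sum_i \sum_j (crd i p * crd j p + crd i (rot p) * crd j (rot p)) *
       partial i (partial j V) p.
  rewrite sum_dirs mulr_sumr; apply: eq_bigr => j _.
  rewrite !sum_dirs -big_split mulr_sumr; apply: eq_bigr => k _.
  rewrite /a /b /c /d /= !mxE; ring.
by field.
Qed.

End SubLaplacian.

(** * The maximum principle *)

(** If c were positive, g would be positive just to the right of 0, as g 0 = 0,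
    and the mean value theorem would make f exceed f 0 there. *)
Lemma second_derivative_at_max (R : realType) (f g : R -> R) (c : R) :
  (forall t, is_derive t (1 : R) f (g t)) -> is_derive 0 (1 : R) g c ->
  (forall t, f t <= f 0) -> c <= 0.
Proof.
move=> df dg fmax; rewrite leNgt; apply/negP => c0.
have g0 : g 0 = 0.
  have h1 : (0 : R) \in `](-1 : R), 1[%R by rewrite in_itv /=; lra.
  have [] := @derive1_at_max R f (-1) 1 0 _ _ h1 _; first by lra.
  - by move=> t _; have [] := df t.
  - by move=> t _; exact: fmax.
  by move=> _; have [_ ->] := df 0.
have gc : (fun h : R => h^-1 *: (g (h *: 1 + 0) - g 0)) @ 0^' --> c.
  by have [h <-] := dg.
have /gc : nbhs c [set x : R | 0 < x] by exact: lt_nbhsr.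
rewrite /= nbhs_filterE => -[/= e /= e0 he].
pose t := e / 2.
have t0 : 0 < t by rewrite divr_gt0.
have [s] := MVT t0 (fun x _ => df x)
  (derivable_within_continuous (fun x _ => @ex_derive _ _ _ _ _ _ _ (df x))).
rewrite in_itv /= => /andP[s0 st] fs.
have : 0 < g s.
  have := he s; rewrite /ball_ /= sub0r normrN gtr0_norm// scaler1 addr0 g0 subr0.
  move=> /(_ _ _); rewrite -[_ *: _]/(s^-1 * g s) pmulr_rgt0 ?invr_gt0//; apply.
    by rewrite (lt_trans st)// /t; lra.
  by rewrite gt_eqF.
have := fmax t; rewrite -subr_le0 fs => h gs.
have : 0 < g s * (t - 0) by rewrite subr0 mulr_gt0.
by rewrite ltNge h.
Qed.

Definition dot (R : realType) (m : nat) (p v : Cspace R m) : R :=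
  \sum_i crd i p * crd i v.

Section MaximumPrinciple.
Variables (R : realType).

Section Dot.
Variable m : nat.
Implicit Types p v u : Cspace R m.

Lemma dotC p v : dot p v = dot v p.
Proof. by apply: eq_bigr => i _; rewrite mulrC. Qed.

Lemma dotDl p v u : dot (p + v) u = dot p u + dot v u.
Proof. by rewrite -big_split; apply: eq_bigr => i _; rewrite crdD mulrDl. Qed.

Lemma dotZl (a : R) p u : dot (a *: p) u = a * dot p u.
Proof. by rewrite mulr_sumr; apply: eq_bigr => i _; rewrite crdZ mulrA. Qed.

Lemma dotDr p u v : dot p (u + v) = dot p u + dot p v.
Proof. by rewrite dotC dotDl ![dot _ p]dotC. Qed.

Lemma dotZr (c : R) p u : dot p (c *: u) = c * dot p u.
Proof. by rewrite dotC dotZl dotC. Qed.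

Lemma dot_bas u i : dot u (bas R i) = crd i u.
Proof.
rewrite /dot (bigD1 i)//= crd_bas eqxx mulr1 big1 ?addr0// => j ji.
by rewrite crd_bas (negbTE ji) mulr0.
Qed.

Lemma is_derive_dot u v p : is_derive p v (dot u) (dot u v).
Proof.
by apply: is_derive_linear_form => h w x; rewrite dotC dotDl dotZl ![dot _ u]dotC.
Qed.

Lemma sum_rank_one u v :
  \sum_i \sum_j (crd i u * crd j u) * (crd i v * crd j v) = dot u v ^+ 2.
Proof.
rewrite expr2 /dot big_distrlr /=; apply: eq_bigr => i _; apply: eq_bigr => j _; ring.
Qed.

Lemma dot_rotl p v : dot (rot p) v = - dot (rot v) p.
Proof.
by rewrite /dot !sum_dirs -sumrN; apply: eq_bigr => j _; rewrite /= !mxE; ring.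
Qed.

Lemma dot_rotrot p v : dot (rot p) (rot v) = dot v p.
Proof.
by rewrite /dot !sum_dirs; apply: eq_bigr => j _; rewrite /= !mxE; ring.
Qed.

Lemma dot_rot p : dot p (rot p) = 0.
Proof.
by rewrite /dot sum_dirs big1// => j _; rewrite /= mxE; ring.
Qed.

Lemma dot_rot2 p : dot (rot p) (rot p) = dot p p.
Proof.
by rewrite /dot !sum_dirs; apply: eq_bigr => j _; rewrite /= mxE; ring.
Qed.

Lemma dot_ge0 p : 0 <= dot p p.
Proof. by apply: sumr_ge0 => i _; rewrite -expr2 sqr_ge0. Qed.

Lemma dot_eq0 p : dot p p = 0 -> p = 0.
Proof.
move=> /eqP; rewrite psumr_eq0; last by move=> i _; rewrite -expr2 sqr_ge0.
move=> /allP h; apply: crd_inj => i.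
have /h := mem_index_enum i; rewrite mulf_eq0 orbb => /eqP ->.
by rewrite -(scale0r (0 : Cspace R m)) crdZ mul0r.
Qed.

End Dot.

Lemma sphere_dot n (p : Cspace R n.+1) : sphere R n p <-> dot p p = 1.
Proof.
rewrite /sphere /= /dot sum_dirs; under eq_bigr do rewrite !expr2.
by split.
Qed.

(** When u is a unit vector orthogonal to p, this is the great circle through p
    with velocity u. *)
Definition circle m (p u : Cspace R m) (t : R) : Cspace R m := cos t *: p + sin t *: u.
Definition circle' m (p u : Cspace R m) (t : R) : Cspace R m := cos t *: u - sin t *: p.

Lemma crd_circle m (p u : Cspace R m) i t :
  crd i (circle p u t) = cos t * crd i p + sin t * crd i u.
Proof. by rewrite crdD !crdZ. Qed.

Lemma crd_circle' m (p u : Cspace R m) i t :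
  crd i (circle' p u t) = cos t * crd i u - sin t * crd i p.
Proof. by rewrite /circle' -scaleNr crdD !crdZ mulNr. Qed.

Lemma is_derive_crd_circle m (p u : Cspace R m) i t :
  is_derive t (1 : R) (fun t => crd i (circle p u t)) (crd i (circle' p u t)).
Proof.
rewrite (_ : (fun _ => _) = (fun t => cos t * crd i p + sin t * crd i u)); last first.
  by apply/funext => x; rewrite crd_circle.
have hc := is_deriveZ (crd i p) (is_derive_cos t).
have hs := is_deriveZ (crd i u) (is_derive_sin t).
rewrite (_ : (fun _ => _) = (crd i p \*: cos) + (crd i u \*: sin)); last first.
  by apply/funext => x; rewrite [_ * crd i p]mulrC [_ * crd i u]mulrC.
apply: (is_derive_eq (is_deriveD hc hs)).
by rewrite crd_circle' addrC [cos t * _]mulrC [sin t * _]mulrC -mulrN.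
Qed.

Lemma is_derive_crd_circle' m (p u : Cspace R m) i t :
  is_derive t (1 : R) (fun t => crd i (circle' p u t)) (- crd i (circle p u t)).
Proof.
rewrite (_ : (fun _ => _) = (fun t => cos t * crd i u - sin t * crd i p)); last first.
  by apply/funext => x; rewrite crd_circle'.
have hc := is_deriveZ (crd i u) (is_derive_cos t).
have hs := is_deriveZ (- crd i p) (is_derive_sin t).
rewrite (_ : (fun _ => _) = (crd i u \*: cos) + ((- crd i p) \*: sin)); last first.
  by apply/funext => x; rewrite [_ * crd i u]mulrC -mulrN [_ * - crd i p]mulrC.
apply: (is_derive_eq (is_deriveD hc hs)).
rewrite crd_circle -[X in X + _]/(crd i u * - sin t) -[X in _ + X]/(- crd i p * cos t).
ring.
Qed.

Lemma is_derive_circle m d (f : Cspace R m -> R) (p u : Cspace R m) t : poly_lt d f ->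
  is_derive t (1 : R) (fun t => f (circle p u t))
   (\sum_i partial i f (circle p u t) * crd i (circle' p u t)).
Proof.
elim=> {d f}.
- move=> d; apply: (is_derive_eq (is_derive_cst _ _ _)).
  by rewrite big1// => i _; rewrite partial_cst mul0r.
- move=> d c; apply: (is_derive_eq (is_derive_cst _ _ _)).
  by rewrite big1// => i _; rewrite partial_cst mul0r.
- move=> d f g df ihf dg ihg; apply: (is_derive_eq (is_deriveD ihf ihg)).
  rewrite -big_split; apply: eq_bigr => i _.
  by rewrite (poly_lt_partialD i df dg) mulrDl.
- move=> d j f df ih.
  apply: (is_derive_eq (is_deriveM (is_derive_crd_circle p u j t) ih)).
  under [RHS]eq_bigr do rewrite (poly_lt_partialX _ _ df) mulrDl.
  rewrite big_split; congr (_ + _).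
    by rewrite [LHS]mulr_sumr; apply: eq_bigr => i _; rewrite mulrA.
  rewrite (bigD1 j)//= eqxx mul1r big1 ?addr0// => i ij.
  by rewrite eq_sym (negbTE ij) !mul0r.
Qed.

Section AtMax.
Variables (n d : nat) (W : Cspace R n.+1 -> R) (p : Cspace R n.+1).
Hypotheses (dW : poly_lt d W) (Sp : sphere R n p).
Hypothesis Wmax : forall x, sphere R n x -> W x <= W p.

(** The second derivative of W along the great circle is the Hessian of W on the
    velocity plus the gradient of W on the acceleration, which is -p at p. *)
Lemma hessian_at_max_unit u : dot u u = 1 -> dot p u = 0 ->
  \sum_i \sum_j partial i (partial j W) p * (crd i u * crd j u) <=
  \sum_i crd i p * partial i W p.
Proof.
move=> uu pu; have pp := (sphere_dot p).1 Sp.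
have Sc t : sphere R n (circle p u t).
  apply/sphere_dot; rewrite /circle dotDl !dotZl ![dot _ (_ + _)]dotC !dotDl !dotZl.
  rewrite pp uu [dot u p]dotC pu.
  by rewrite -[RHS](cos2Dsin2 t); ring.
have c0 : circle p u 0 = p by rewrite /circle cos0 sin0 scale1r scale0r addr0.
have c0' : circle' p u 0 = u by rewrite /circle' cos0 sin0 scale1r scale0r subr0.
have dg : is_derive 0 (1 : R)
   (fun t => \sum_i partial i W (circle p u t) * crd i (circle' p u t))
   (\sum_i (\sum_j partial j (partial i W) p * crd j u * crd i u - partial i W p * crd i p)).
  have h i : is_derive 0 (1 : R) (fun t => partial i W (circle p u t) * crd i (circle' p u t))
     (\sum_j partial j (partial i W) p * crd j u * crd i u - partial i W p * crd i p).
    have := is_deriveM (is_derive_circle p u 0 (poly_lt_partial i dW))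
       (is_derive_crd_circle' p u i 0).
    rewrite c0 c0' => h; apply: (is_derive_eq h).
    rewrite addrC; congr (_ + _); last by rewrite -mulrN.
    by rewrite [LHS]mulr_sumr; apply: eq_bigr => j _; rewrite mulrC.
  rewrite (_ : (fun _ => _) =
    (\sum_i (fun t => partial i W (circle p u t) * crd i (circle' p u t)))); last first.
    by apply/funext => t; rewrite fct_sumE.
  apply: (big_ind2 (fun F c => is_derive 0 (1 : R) F c)).
  - exact: is_derive_cst.
  - by move=> F c G e hF hG; exact: is_deriveD.
  - by move=> i _; exact: h.
have := second_derivative_at_max (fun t => is_derive_circle p u t dW) dg _.
rewrite c0 => /(_ (fun t => Wmax (Sc t))).
rewrite sumrB subr_le0.
rewrite (_ : \sum_i _ = \sum_i \sum_j partial i (partial j W) p * (crd i u * crd j u)).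
  move=> /le_trans; apply; rewrite le_eqVlt; apply/orP; left; apply/eqP.
  by apply: eq_bigr => i _; rewrite mulrC.
rewrite exchange_big; apply: eq_bigr => i _; apply: eq_bigr => j _.
by rewrite mulrA.
Qed.

Lemma hessian_at_max v : dot p v = 0 ->
  \sum_i \sum_j partial i (partial j W) p * (crd i v * crd j v) <=
  dot v v * \sum_i crd i p * partial i W p.
Proof.
move=> pv; have [v0|v0] := eqVneq (dot v v) 0.
  rewrite v0 mul0r (dot_eq0 v0) big1// => i _; rewrite big1// => j _.
  by rewrite -(scale0r (0 : Cspace R n.+1)) crdZ !mul0r mulr0.
pose c := Num.sqrt (dot v v).
have c2 : c ^+ 2 = dot v v by rewrite sqr_sqrtr// dot_ge0.
have c0 : c != 0 by rewrite -sqrf_eq0 c2.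
have uu : dot (c^-1 *: v) (c^-1 *: v) = 1.
  by rewrite dotZl dotC dotZl -c2; field.
have pu : dot p (c^-1 *: v) = 0 by rewrite dotC dotZl dotC pv mulr0.
have := hessian_at_max_unit uu pu.
rewrite -(ler_pM2l (_ : 0 < c ^+ 2)); last by rewrite exprn_even_gt0.
rewrite -c2; apply: le_trans; rewrite le_eqVlt; apply/orP; left; apply/eqP.
rewrite mulr_sumr; apply: eq_bigr => i _; rewrite mulr_sumr; apply: eq_bigr => j _.
rewrite !crdZ; by field.
Qed.

(** The projection of a basis vector on the complex orthogonal complement of p. *)
Definition proj_dir (k : dirs n.+1) : Cspace R n.+1 :=
  bas R k - crd k p *: p - crd k (rot p) *: rot p.

Lemma crd_proj_dir k i : crd i (proj_dir k) =
  (i == k)%:R - crd i p * crd k p - crd i (rot p) * crd k (rot p).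
Proof.
by rewrite /proj_dir -[- (crd k p *: p)]scaleNr -[- (_ *: rot p)]scaleNr !crdD !crdZ crd_bas; ring.
Qed.

Lemma sum_proj_dir i (F : dirs n.+1 -> R) :
  \sum_k crd i (proj_dir k) * F k =
  F i - crd i p * (\sum_k crd k p * F k) - crd i (rot p) * (\sum_k crd k (rot p) * F k).
Proof.
under eq_bigr do rewrite crd_proj_dir.
under eq_bigr do rewrite !mulrBl -!mulrA.
rewrite !sumrB -!mulr_sumr; congr (_ - _ - _).
rewrite (bigD1 i)//= eqxx mul1r big1 ?addr0// => k ki.
by rewrite eq_sym (negbTE ki) mul0r.
Qed.

Lemma crd_proj_dirC i k : crd i (proj_dir k) = crd k (proj_dir i).
Proof. by rewrite !crd_proj_dir eq_sym; ring. Qed.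

Lemma dot_proj_dir k : dot p (proj_dir k) = 0 /\ dot (rot p) (proj_dir k) = 0.
Proof.
have pp : \sum_k crd k p * crd k p = 1 := (sphere_dot p).1 Sp.
have pr : \sum_k crd k p * crd k (rot p) = 0 := dot_rot p.
have rp : \sum_k crd k (rot p) * crd k p = 0 by rewrite -[LHS]/(dot (rot p) p) dotC dot_rot.
have rr : \sum_k crd k (rot p) * crd k (rot p) = 1.
  by rewrite -[LHS]/(dot (rot p) (rot p)) dot_rot2.
have e q : dot q (proj_dir k) = \sum_i crd k (proj_dir i) * crd i q.
  by apply: eq_bigr => i _; rewrite mulrC crd_proj_dirC.
by rewrite !e !sum_proj_dir pp pr rp rr; split; ring.
Qed.

Lemma proj_dir_idem i j :
  \sum_k crd i (proj_dir k) * crd j (proj_dir k) = crd i (proj_dir j).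
Proof.
rewrite sum_proj_dir; have [h1 h2] := dot_proj_dir j.
have e q : \sum_k crd k q * crd j (proj_dir k) = dot q (proj_dir j).
  by apply: eq_bigr => k _; rewrite crd_proj_dirC.
by rewrite !e h1 h2 !mulr0 !subr0 crd_proj_dirC.
Qed.

Lemma sum_dot_proj_dir : \sum_k dot (proj_dir k) (proj_dir k) = 2 * n%:R.
Proof.
rewrite exchange_big; under eq_bigr do rewrite proj_dir_idem crd_proj_dir.
rewrite !sumrB -/(dot p p) -/(dot (rot p) (rot p)) dot_rot2 ((sphere_dot p).1 Sp).
under eq_bigr do rewrite eqxx.
rewrite sumr_const card_sum card_ord -mulr_natl mulr1 natrD -natr1; ring.
Qed.

(** Summing the second order condition over the projections of the basis
    vectors gives the trace of the Hessian over the complex orthogonal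
    complement of p on one side, since a projection is idempotent, and the trace
    2n of that projection times the radial derivative on the other. *)
Lemma sublap_at_max : sublap W p <= 0.
Proof.
have : \sum_k \sum_i \sum_j partial i (partial j W) p *
      (crd i (proj_dir k) * crd j (proj_dir k)) <=
   2 * n%:R * \sum_i crd i p * partial i W p.
  rewrite -sum_dot_proj_dir mulr_suml; apply: ler_sum => k _.
  by apply: hessian_at_max; have [] := dot_proj_dir k.
rewrite exchange_big -subr_le0 => h.
rewrite /sublap pmulr_rle0 ?invr_gt0//; apply: le_trans h.
rewrite lerD2r le_eqVlt; apply/orP; left; apply/eqP.
rewrite -sumrB; apply: eq_bigr => i _.
rewrite exchange_big /=; under [RHS]eq_bigr do rewrite -mulr_sumr proj_dir_idem crd_proj_dir.
rewrite [X in X - _](_ : _ = \sum_j (i == j)%:R * partial i (partial j W) p).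
  by rewrite -sumrB; apply: eq_bigr => j _; ring.
rewrite (bigD1 i)//= eqxx mul1r big1 ?addr0// => k ki.
by rewrite eq_sym (negbTE ki) mul0r.
Qed.

End AtMax.

End MaximumPrinciple.

(** * The conformal sublaplacian on polynomials *)

Section Sphere.
Variables (R : realType) (n : nat).
Implicit Types p : Cspace R n.+1.

Lemma continuous_sum (T : topologicalType) (J : Type) (r : seq J) (F : J -> T -> R) x :
  (forall j, {for x, continuous (F j)}) ->
  {for x, continuous (fun y => \sum_(j <- r) F j y)}.
Proof.
move=> cF; elim: r => [|j r ih].
  by rewrite (_ : (fun _ => _) = cst 0)//; [exact: cvg_cst|apply/funext => y; rewrite big_nil].
rewrite (_ : (fun _ => _) = F j \+ (fun y => \sum_(k <- r) F k y)).
  by apply: continuousD; [exact: cF|exact: ih].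
by apply/funext => y; rewrite big_cons.
Qed.

Lemma sphere_coord_le p i : sphere R n p -> crd i p ^+ 2 <= 1.
Proof.
move=> /sphere_dot <-; rewrite /dot (bigD1 i)//= -expr2 lerDl.
by apply: sumr_ge0 => j _; rewrite -expr2 sqr_ge0.
Qed.

Lemma sphere_compact : compact (sphere R n).
Proof.
pose K : set 'rV[R]_n.+1 := [set v | forall i, `[-1, 1]%classic (v ord0 i)].
have cK : compact K.
  apply: (@rV_compact R n.+1 (fun=> `[-1, 1]%classic)) => _; exact: segment_compact.
apply: (subclosed_compact _ (compact_setX cK cK)).
  rewrite (_ : sphere R n = (fun p => dot p p) @^-1` [set 1]); last first.
    by apply/seteqP; split=> p /= /sphere_dot.
  apply: preimage_closed; last exact: closed_eq.
  move=> p _; apply: continuous_sum => i.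
  by apply: continuousM; exact: continuous_crd.
move=> p Sp; split => i; rewrite set_itvE /= -ler_norml -(ler_pXn2r (_ : 0 < 2)%N)//
  ?nnegrE// expr1n real_normK ?num_real//.
  exact: (sphere_coord_le (inl i) Sp).
exact: (sphere_coord_le (inr i) Sp).
Qed.

End Sphere.

Section Solvability.
Variables (R : realType) (n : nat).
Implicit Types (p : Cspace R n.+1) (V W : Cspace R n.+1 -> R).

Lemma poly_lt_crd_pred d i V : poly_lt d.-1 V -> poly_lt d (fun p => crd i p * V p).
Proof.
case: d => [/poly_lt0_eq0 ->//|d]; last exact: poly_lt_crd.
by apply: poly_lt_eq (poly_lt0 _ _ _) => p; rewrite mulr0.
Qed.

Lemma poly_lt_rot_pred d i V : poly_lt d.-1 V -> poly_lt d (fun p => crd i (rot p) * V p).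
Proof.
case: i => j dV; last exact: (@poly_lt_crd_pred d (inl j)).
apply: poly_lt_eq (poly_lt_scale (-1) (@poly_lt_crd_pred d (inr j) V dV)) => p.
by rewrite /= mxE; ring.
Qed.

(** Every coefficient has degree at most the order of the derivative that it
    multiplies, so the degree does not increase. *)
Lemma poly_lt_sublap d V : poly_lt d V -> poly_lt d (sublap V).
Proof.
move=> dV; apply: poly_lt_scale; apply: poly_ltB; first apply: poly_ltB.
- apply: poly_lt_sum => i; apply: (@poly_lt_widen _ _ d.-1.-1); last first.
    by do 2!apply: poly_lt_partial.
  by rewrite (leq_trans (leq_pred _))// leq_pred.
- apply: poly_lt_sum => i; apply: poly_lt_sum => j.
  have dij : poly_lt d.-1.-1 (partial i (partial j V)) by do 2!apply: poly_lt_partial.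
  apply: (@poly_lt_eq _ _ _ (fun p => crd i p * (crd j p * partial i (partial j V) p) +
     crd i (rot p) * (crd j (rot p) * partial i (partial j V) p))) => [p|]; first by ring.
  apply: poly_ltD.
    by do 2!apply: poly_lt_crd_pred.
  by do 2!apply: poly_lt_rot_pred.
- apply: poly_lt_scale; apply: poly_lt_sum => i.
  by apply: poly_lt_crd_pred; exact: poly_lt_partial.
Qed.

Definition conf_lap V p : R := n%:R ^+ 2 / 4 * V p - sublap V p.

Lemma poly_lt_conf_lap d V : poly_lt d V -> poly_lt d (conf_lap V).
Proof.
by move=> dV; apply: poly_ltB; [exact: poly_lt_scale|exact: poly_lt_sublap].
Qed.

Lemma sublap0 p : sublap (fun=> 0 : R) p = 0.
Proof.
rewrite /sublap !big1 ?subr0 ?mulr0 ?subr0 ?mulr0// => i _; rewrite ?partial_cst ?mulr0//.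
by rewrite big1// => j _; rewrite !partial_cst mulr0.
Qed.

(** The regularity used by the linearity of [sublap]; it covers polynomials on
    the whole space as well as bubbles, which are regular near the sphere only. *)
Definition twice_derivable_on (U : set (Cspace R n.+1)) V := forall p, U p ->
  (forall i, derivable V p (bas R i)) /\
  forall i j, derivable (partial i V) p (bas R j).

Lemma poly_lt_twice_derivable d V : poly_lt d V -> twice_derivable_on setT V.
Proof.
move=> dV p _; split=> [i|i j].
  by have [] := poly_lt_is_derive i p dV.
by have [] := poly_lt_is_derive j p (poly_lt_partial i dV).
Qed.

Lemma is_derive_linear (a b : R) V W p i :
  derivable V p (bas R i) -> derivable W p (bas R i) ->
  is_derive p (bas R i) (fun q => a * V q + b * W q) (a * partial i V p + b * partial i W p).
Proof.
move=> /derivableP dV /derivableP dW; rewrite !partialE.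
exact: (is_deriveD (is_deriveZ a dV) (is_deriveZ b dW)).
Qed.

Section Linearity.
Variables (U : set (Cspace R n.+1)) (a b : R) (V W : Cspace R n.+1 -> R).
Hypotheses (oU : open U) (VU : twice_derivable_on U V) (WU : twice_derivable_on U W).
Let Z p := a * V p + b * W p.

Lemma partial_linear i p : U p -> partial i Z p = a * partial i V p + b * partial i W p.
Proof.
move=> Up; rewrite [LHS]partialE.
by have [_ ->] := is_derive_linear a b ((VU Up).1 i) ((WU Up).1 i).
Qed.

Lemma near_partial_linear i p : U p ->
  \near p, a * partial i V p + b * partial i W p = partial i Z p.
Proof.
move=> Up; near=> q; rewrite partial_linear//; near: q.
exact: open_nbhs_nbhs (conj oU Up).
Unshelve. all: by end_near. Qed.

Lemma is_derive_partial_linear i j p : U p -> is_derive p (bas R i) (partial j Z)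
  (a * partial i (partial j V) p + b * partial i (partial j W) p).
Proof.
move=> Up; apply: near_eq_is_derive (near_partial_linear j Up) _.
by apply: is_derive_linear; [exact: (VU Up).2|exact: (WU Up).2].
Qed.

Lemma partial_partial_linear i j p : U p -> partial i (partial j Z) p =
  a * partial i (partial j V) p + b * partial i (partial j W) p.
Proof.
by move=> Up; rewrite [LHS]partialE; have [_ ->] := is_derive_partial_linear i j Up.
Qed.

Lemma twice_derivable_linear : twice_derivable_on U Z.
Proof.
move=> p Up; split=> [i|i j].
  by have [] := is_derive_linear a b ((VU Up).1 i) ((WU Up).1 i).
by have [] := is_derive_partial_linear j i Up.
Qed.

Lemma sublap_linear p : U p -> sublap Z p = a * sublap V p + b * sublap W p.
Proof.
move=> Up; rewrite /sublap.
under eq_bigr do rewrite (partial_partial_linear _ _ Up).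
under [X in _ - X - _]eq_bigr do under eq_bigr do
  rewrite (partial_partial_linear _ _ Up) mulrDr mulrCA [_ * (b * _)]mulrCA.
under [X in _ - _ * X]eq_bigr do rewrite (partial_linear _ Up) mulrDr mulrCA [_ * (b * _)]mulrCA.
under [X in _ - X - _]eq_bigr do rewrite big_split -!mulr_sumr.
by rewrite !big_split -!mulr_sumr /=; ring.
Qed.

End Linearity.

Lemma sublapD d V W : poly_lt d V -> poly_lt d W ->
  sublap (fun p => V p + W p) = fun p => sublap V p + sublap W p.
Proof.
move=> /poly_lt_twice_derivable dV /poly_lt_twice_derivable dW; apply/funext => p.
have := sublap_linear 1 1 (@openT _) dV dW (I : setT p).
rewrite !mul1r => <-; congr (sublap _ p); apply/funext => q; ring.
Qed.

Lemma sublapZ d (a : R) V : poly_lt d V ->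
  sublap (fun p => a * V p) = fun p => a * sublap V p.
Proof.
move=> /poly_lt_twice_derivable dV; apply/funext => p.
have := sublap_linear a 0 (@openT _) dV dV (I : setT p).
rewrite mul0r addr0 => <-; congr (sublap _ p); apply/funext => q; ring.
Qed.

Lemma conf_lapD d V W : poly_lt d V -> poly_lt d W ->
  conf_lap (fun p => V p + W p) = fun p => conf_lap V p + conf_lap W p.
Proof.
by move=> dV dW; apply/funext => p; rewrite /conf_lap (sublapD dV dW); ring.
Qed.

Lemma conf_lapZ d (a : R) V : poly_lt d V ->
  conf_lap (fun p => a * V p) = fun p => a * conf_lap V p.
Proof.
by move=> dV; apply/funext => p; rewrite /conf_lap (sublapZ a dV); ring.
Qed.

Lemma conf_lap_sum d (J : Type) (r : seq J) (F : J -> Cspace R n.+1 -> R) (a : J -> R) :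
  (forall j, poly_lt d (F j)) ->
  conf_lap (fun p => \sum_(j <- r) a j * F j p) =
  fun p => \sum_(j <- r) a j * conf_lap (F j) p.
Proof.
move=> dF; elim: r => [|j r ih].
  rewrite (_ : (fun _ => _) = fun=> 0); last by apply/funext => p; rewrite big_nil.
  by apply/funext => p; rewrite /conf_lap sublap0 big_nil; ring.
rewrite (_ : (fun _ => _) = fun p => a j * F j p + \sum_(k <- r) a k * F k p).
  rewrite (@conf_lapD d); first rewrite ih (conf_lapZ _ (dF j)).
  - by apply/funext => p; rewrite big_cons.
  - exact: poly_lt_scale.
  - by apply: poly_lt_sum => k; exact: poly_lt_scale.
by apply/funext => p; rewrite big_cons.
Qed.

Hypothesis n_gt0 : (0 < n)%N.

(** At a maximum point of W on the sphere the sublaplacian is nonpositive, so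
    n^2/4 times the maximum is at most the value of [conf_lap W] there. *)
Lemma conf_lap_upper_bound d W (B : R) : poly_lt d W ->
  (forall p, sphere R n p -> conf_lap W p <= B) ->
  forall p, sphere R n p -> W p <= 4 / n%:R ^+ 2 * B.
Proof.
move=> dW LB p Sp.
have [q Sq Wq] := compact_EVT_max (ex_intro _ p Sp) (@sphere_compact R n)
   (continuous_subspaceT (poly_lt_continuous dW)).
move: Sq => /set_mem Sq.
have Wmax x : sphere R n x -> W x <= W q by move=> Sx; apply: Wq; exact: mem_set.
apply: (le_trans (Wmax p Sp)).
have := sublap_at_max dW Sq Wmax; have := LB q Sq; rewrite /conf_lap.
have N0 : 0 < n%:R ^+ 2 :> R by rewrite exprn_gt0// ltr0n.
move=> h1 h2; have h : n%:R ^+ 2 / 4 * W q <= B by lra.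
rewrite -(ler_pM2l (_ : 0 < n%:R ^+ 2 / 4)); last by rewrite divr_gt0.
apply: le_trans h _; rewrite le_eqVlt; apply/orP; left; apply/eqP; field.
by rewrite gt_eqF// ltr0n.
Qed.

Lemma conf_lap_bound d W (B : R) : poly_lt d W ->
  (forall p, sphere R n p -> `|conf_lap W p| <= B) ->
  forall p, sphere R n p -> `|W p| <= 4 / n%:R ^+ 2 * B.
Proof.
move=> dW LB p Sp; rewrite ler_norml lerNl; apply/andP; split; last first.
  by apply: (conf_lap_upper_bound dW) => // q Sq; rewrite (le_trans _ (LB q Sq))// ler_norm.
rewrite -mulN1r; apply: (conf_lap_upper_bound (poly_lt_scale (-1) dW)) => // q Sq.
by rewrite (conf_lapZ _ dW) mulN1r (le_trans _ (LB q Sq))// -normrN ler_norm.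
Qed.

Lemma conf_lap_inj d W : poly_lt d W -> (forall p, sphere R n p -> conf_lap W p = 0) ->
  forall p, sphere R n p -> W p = 0.
Proof.
move=> dW W0 p Sp; apply/eqP; rewrite -normr_le0 -(mulr0 (4 / n%:R ^+ 2)).
by apply: (conf_lap_bound dW) => // q Sq; rewrite W0// normr0.
Qed.

End Solvability.

(** * Solvability in polynomials *)

Lemma linear_dependence (F : fieldType) (J : finType) (c : nat -> J -> F) :
  exists a : nat -> F,
    (exists2 i, (i < #|J|.+1)%N & a i != 0) /\
    forall j, \sum_(i < #|J|.+1) a i * c i j = 0.
Proof.
pose A : 'M[F]_(#|J|.+1, #|J|) := \matrix_(i, j) c i (enum_val j).
have : kermx A != 0.
  rewrite kermx_eq0 /row_free; apply/eqP => rA.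
  by have := rank_leq_col A; rewrite rA ltnn.
move=> /rowV0Pn[v /sub_kermxP vA v0].
have [i vi] : exists i, v ord0 i != 0.
  apply/existsP; apply: contraNT v0; rewrite negb_exists => /forallP h.
  by apply/eqP/rowP => i; rewrite mxE; apply/eqP; rewrite -[_ == _]negbK.
exists (fun k => v ord0 (inord k)); split.
  by exists i => //; rewrite inord_val.
move=> j; have /rowP/(_ (enum_rank j)) := vA; rewrite !mxE => h; rewrite -[RHS]h.
by apply: eq_bigr => k _; rewrite inord_val mxE enum_rankK.
Qed.

Section PolynomialSpace.
Variables (R : realType) (m : nat).

Lemma poly_lt_split e d (f : Cspace R m -> R) : poly_lt e f -> e = d.+1 ->
  exists c (h : dirs m -> Cspace R m -> R), (forall i, poly_lt d (h i)) /\
    forall p, f p = c + \sum_i crd i p * h i p.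
Proof.
elim=> {e f}.
- move=> e _; exists 0, (fun=> fun=> 0); split=> [i|p]; first exact: poly_lt0.
  by rewrite big1 ?addr0// => i _; rewrite mulr0.
- move=> e c _; exists c, (fun=> fun=> 0); split=> [i|p]; first exact: poly_lt0.
  by rewrite big1 ?addr0// => i _; rewrite mulr0.
- move=> e f g _ ihf _ ihg ed; have [c [h [dh fE]]] := ihf ed.
  have [c' [h' [dh' gE]]] := ihg ed.
  exists (c + c'), (fun i p => h i p + h' i p); split=> [i|p]; first exact: poly_ltD.
  rewrite fE gE; under [in RHS]eq_bigr do rewrite mulrDr.
  by rewrite big_split /=; ring.
- move=> e i f df _ [ed]; exists 0, (fun k => if k == i then f else fun=> 0).
  split=> [k|p]; first by case: ifP => _; [rewrite -ed|exact: poly_lt0].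
  rewrite (bigD1 i)//= eqxx big1 ?addr0 ?add0r// => k /negbTE ->.
  by rewrite mulr0.
Qed.

(** A polynomial is a constant plus a combination of the coordinates with
    coefficients of smaller degree; hence generators for d give generators for
    d + 1, namely 1 and all products of a coordinate and a generator. *)
Lemma poly_lt_finitely_generated d :
  exists (J : finType) (g : J -> Cspace R m -> R), forall f, poly_lt d f ->
    exists c : J -> R, forall p, f p = \sum_j c j * g j p.
Proof.
elim: d => [|d [J [g ih]]].
  exists void, (fun=> fun=> 0) => f /poly_lt0_eq0 ->//.
  by exists (fun=> 0) => p; rewrite big1// => j _; rewrite mulr0.
exists ('I_1 + (dirs m * J))%type,
  (fun o p => if o is inr (i, j) then crd i p * g j p else 1) => f df.
have [c [h [dh fE]]] := poly_lt_split df erefl.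
have /choice[a aE] : forall i, exists c : J -> R, forall p, h i p = \sum_j c j * g j p.
  by move=> i; exact: ih.
exists (fun o => if o is inr (i, j) then a i j else c) => p.
rewrite fE [RHS]big_sumType big_ord1 /= mulr1; congr (_ + _).
transitivity (\sum_i \sum_j a i j * (crd i p * g j p)).
  apply: eq_bigr => i _; rewrite aE mulr_sumr; apply: eq_bigr => j _.
  by rewrite mulrCA.
by rewrite pair_bigA; apply: eq_bigr => -[i j] _.
Qed.

End PolynomialSpace.

Section Surjectivity.
Variables (R : realType) (n : nat).
Hypothesis n_gt0 : (0 < n)%N.
Implicit Types (p : Cspace R n.+1) (f : Cspace R n.+1 -> R).

Lemma poly_lt_iter_conf_lap d f k : poly_lt d f -> poly_lt d (iter k (@conf_lap R n) f).
Proof. by move=> df; elim: k => //= k; exact: poly_lt_conf_lap. Qed.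

(** In a relation between the iterates of f under L, the lowest iterates with
    zero coefficient can be dropped since L is injective on the sphere.  Then f
    itself appears with a nonzero coefficient, and all the other terms are in
    the image of L. *)
Lemma conf_lap_preimage_of_dependence d f (df : poly_lt d f) N (a : nat -> R) :
  (exists2 i, (i < N)%N & a i != 0) ->
  (forall p, sphere R n p -> \sum_(i < N) a i * iter i (@conf_lap R n) f p = 0) ->
  exists2 w, poly_lt d w & forall p, sphere R n p -> conf_lap w p = f p.
Proof.
elim: N a => [a [] //|N ih a [i iN ai] a0].
pose g p := \sum_(k < N) a k.+1 * iter k (@conf_lap R n) f p.
have dg : poly_lt d g.
  apply: poly_lt_sum => k; apply: poly_lt_scale; exact: poly_lt_iter_conf_lap.
have gE p : conf_lap g p = \sum_(k < N) a k.+1 * iter k.+1 (@conf_lap R n) f p.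
  rewrite /g (conf_lap_sum (d := d) _ (fun k : 'I_N => a k.+1))//.
  by move=> k; exact: poly_lt_iter_conf_lap.
have sE p : \sum_(k < N.+1) a k * iter k (@conf_lap R n) f p = a 0%N * f p + conf_lap g p.
  by rewrite big_ord_recl gE.
have [a00|a00] := eqVneq (a 0%N) 0.
  apply: (ih (fun k => a k.+1)).
    by case: i iN ai => [|i] iN; [rewrite a00 eqxx|exists i].
  apply: (conf_lap_inj n_gt0 dg) => p Sp.
  by have := a0 p Sp; rewrite sE a00 mul0r add0r.
exists (fun p => - (a 0%N)^-1 * g p); first exact: poly_lt_scale.
move=> p Sp; rewrite (conf_lapZ _ dg).
have : conf_lap g p = - (a 0%N * f p).
  by apply/eqP; rewrite -addr_eq0 addrC -sE a0.
by move=> ->; field.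
Qed.

(** Using Cayley-Hamilton in the guise of a dependence between iterates avoids
    choosing a basis of the space of restrictions to the sphere, on which
    relations between monomials are not explicit. *)
Lemma conf_lap_surj d f : poly_lt d f ->
  exists2 w, poly_lt d w & forall p, sphere R n p -> conf_lap w p = f p.
Proof.
move=> df; have [J [g gE]] := poly_lt_finitely_generated R n.+1 d.
have /choice[c cE] : forall k, exists c : J -> R, forall p,
    iter k (@conf_lap R n) f p = \sum_j c j * g j p.
  by move=> k; apply: gE; exact: poly_lt_iter_conf_lap.
have [a [a0 aE]] := linear_dependence c.
apply: (conf_lap_preimage_of_dependence df a0) => p _.
under eq_bigr do rewrite cE mulr_sumr.
rewrite exchange_big big1// => j _; under eq_bigr do rewrite mulrA.
by rewrite -mulr_suml aE mul0r.
Qed.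

End Surjectivity.

(** * Uniform approximation by polynomials *)

Section AbsoluteValue.
Variable R : realType.
Implicit Types (s t : R).

(** The classical increasing sequence of polynomials in t that converges to
    |t| on [-1, 1]. *)
Fixpoint abs_approx (k : nat) t : R :=
  if k is k'.+1 then abs_approx k' t + 2^-1 * (t * t - abs_approx k' t * abs_approx k' t) else 0.

(** With a = |t| and q the current term, the error a - q is multiplied by
    1 - (a + q)/2, which lies between 0 and 1 - a/2. *)
Lemma abs_approx_bounds k t : `|t| <= 1 ->
  [/\ 0 <= abs_approx k t, abs_approx k t <= `|t| &
      `|t| - abs_approx k t <= `|t| * (1 - `|t| / 2) ^+ k].
Proof.
move=> t1; have a0 : 0 <= `|t| by [].
have tt : t * t = `|t| * `|t| by rewrite -!expr2 real_normK ?num_real.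
elim: k => [|k [h1 h2 h3]] /=; first by split; rewrite ?subr0 ?expr0 ?mulr1.
rewrite tt; move: (abs_approx k t) (`|t|) h1 h2 h3 a0 t1 => q a h1 h2 h3 a0 t1.
have e : a - (q + 2^-1 * (a * a - q * q)) = (a - q) * (1 - (a + q) / 2) by field.
split.
- by apply: addr_ge0 => //; apply: mulr_ge0 => //; rewrite subr_ge0 ler_pM.
- by rewrite -subr_ge0 e; apply: mulr_ge0; lra.
- rewrite e exprSr mulrA; apply: (@le_trans _ _ ((a - q) * (1 - a / 2))).
    by apply: ler_wpM2l; lra.
  by apply: ler_wpM2r => //; lra.
Qed.

Lemma geometric_decay k s : 0 <= s -> s <= 1 -> (1 - s) ^+ k * (1 + k%:R * s) <= 1.
Proof.
move=> s0 s1; elim: k => [|k ih]; first by rewrite expr0 mul0r addr0 mulr1.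
apply: le_trans ih; rewrite exprSr -mulrA; apply: ler_wpM2l.
  by rewrite exprn_ge0// subr_ge0.
rewrite -natr1; have k0 : 0 <= k%:R :> R by [].
rewrite -subr_ge0 (_ : _ - _ = s * s * (k%:R + 1)); last by ring.
by rewrite mulr_ge0// ?mulr_ge0// addr_ge0.
Qed.

Lemma abs_approx_error k t : `|t| <= 1 -> `| `|t| - abs_approx k t| <= 2 / k.+1%:R.
Proof.
move=> t1; have [h1 h2 h3] := abs_approx_bounds k t1.
rewrite ger0_norm ?subr_ge0//; apply: le_trans h3 _.
have a0 : 0 <= `|t| by [].
move: (`|t|) a0 t1 => a a0 a1 {h1 h2}.
have s0 : 0 <= a / 2 by lra.
have s1 : a / 2 <= 1 by lra.
rewrite ler_pdivlMr ?ltr0n//.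
have k0 : 0 <= k%:R :> R by [].
have p0 : 0 <= (1 - a / 2) ^+ k by rewrite exprn_ge0// subr_ge0.
have := geometric_decay k s0 s1.
move: ((1 - a / 2) ^+ k) p0 => b b0 h.
have : b * (a / 2 * k.+1%:R) <= b * (1 + k%:R * (a / 2)).
  by apply: ler_wpM2l => //; rewrite -[k.+1%:R]natr1 mulrDr; lra.
move=> /le_trans/(_ h); lra.
Qed.

End AbsoluteValue.

Lemma nbhs_dot (R : realType) (m : nat) (y : Cspace R m) (U : set (Cspace R m)) :
  nbhs y U -> exists2 d : R, 0 < d & forall x, dot (x - y) (x - y) < d -> U x.
Proof.
move=> /nbhs_ballP[r /= r0 rU]; exists (r ^+ 2); first by rewrite exprn_gt0.
move=> x xy; apply: rU.
have h i : `|crd i y - crd i x| < r.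
  rewrite distrC -(ltr_pXn2r (_ : 0 < 2)%N)// ?nnegrE ?(ltW r0)// real_normK ?num_real//.
  apply: le_lt_trans xy; rewrite /dot (bigD1 i)//= -expr2.
  rewrite -[- y]scaleN1r crdD crdZ mulN1r lerDl.
  by apply: sumr_ge0 => j _; rewrite -expr2 sqr_ge0.
split; split=> // i j; rewrite !(ord1 i).
  exact: (h (inl j)).
exact: (h (inr j)).
Qed.

Lemma compact_finite_cover (R : realType) (m : nat) (K : set (Cspace R m)) :
  compact K -> cover_compact K.
Proof.
pose T : ptopologicalType :=
  HB.pack (Cspace R m) (Pointed.class (Cspace R m)) (Topological.class (Cspace R m)).
by rewrite (@compact_cover T).
Qed.

Section Weierstrass.
Variables (R : realType) (m : nat) (K : set (Cspace R m)).
Hypothesis cK : compact K.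
Implicit Types (f g W : Cspace R m -> R).

Definition polynomial W := exists d, poly_lt d W.

Definition poly_approx f := forall e : R, 0 < e ->
  exists2 W, polynomial W & forall p, K p -> `|f p - W p| <= e.

Lemma polynomialC (c : R) : polynomial (fun=> c).
Proof. by exists 1%N; exact: poly_ltC. Qed.

Lemma polynomialD V W : polynomial V -> polynomial W -> polynomial (fun p => V p + W p).
Proof.
move=> [d dV] [e eW]; exists (maxn d e).
by apply: poly_ltD; [exact: poly_lt_widen (leq_maxl _ _) dV|
  exact: poly_lt_widen (leq_maxr _ _) eW].
Qed.

Lemma polynomialM V W : polynomial V -> polynomial W -> polynomial (fun p => V p * W p).
Proof. by move=> [d dV] [e eW]; exists (d + e)%N; exact: poly_ltM. Qed.

Lemma polynomialB V W : polynomial V -> polynomial W -> polynomial (fun p => V p - W p).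
Proof.
move=> pV pW; have [d h] := polynomialD pV (polynomialM (polynomialC (-1)) pW).
by exists d; apply: poly_lt_eq h => p; rewrite mulN1r.
Qed.

Lemma polynomial_crd i : polynomial (crd i).
Proof.
exists 2; apply: (@poly_lt_eq _ _ _ (fun p => crd i p * 1)) => [p|].
  by rewrite mulr1.
by apply: poly_ltX; exact: poly_ltC.
Qed.

Lemma polynomial_sum (J : Type) (r : seq J) (F : J -> Cspace R m -> R) :
  (forall j, polynomial (F j)) -> polynomial (fun p => \sum_(j <- r) F j p).
Proof.
move=> pF; elim: r => [|j r ih].
  by rewrite (_ : (fun _ => _) = fun=> 0); [exact: polynomialC|apply/funext => p; rewrite big_nil].
rewrite (_ : (fun _ => _) = fun p => F j p + \sum_(k <- r) F k p); first exact: polynomialD.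
by apply/funext => p; rewrite big_cons.
Qed.

Lemma polynomial_continuous W : polynomial W -> continuous W.
Proof. by move=> [d dW]; exact: poly_lt_continuous dW. Qed.

Lemma within_continuous_bounded f : {within K, continuous f} ->
  exists2 B : R, 0 < B & forall p, K p -> `|f p| <= B.
Proof.
move=> cf; have /compact_bounded[M [Mr hM]] := continuous_compact cf cK.
exists (`|M| + 1) => [|p Kp]; first by rewrite ltr_wpDl.
by apply: hM; [rewrite (le_lt_trans (ler_norm _))// ltrDl|exists p].
Qed.

Lemma poly_approx_polynomial W : polynomial W -> poly_approx W.
Proof. by move=> pW e e0; exists W => // p _; rewrite subrr normr0 ltW. Qed.

Lemma poly_approxD f g : poly_approx f -> poly_approx g ->
  poly_approx (fun p => f p + g p).
Proof.
move=> af ag e e0; have e2 : 0 < e / 2 by rewrite divr_gt0.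
have [V pV hV] := af _ e2; have [W pW hW] := ag _ e2.
exists (fun p => V p + W p); first exact: polynomialD.
move=> p Kp; rewrite opprD addrACA (le_trans (ler_normD _ _))//.
by have := hV p Kp; have := hW p Kp; lra.
Qed.

Lemma poly_approxZ (c : R) f : poly_approx f -> poly_approx (fun p => c * f p).
Proof.
move=> af e e0; have [|V pV hV] := af (e / (`|c| + 1)); first by rewrite divr_gt0// ltr_wpDl.
exists (fun p => c * V p); first exact: polynomialM (polynomialC c) pV.
move=> p Kp; rewrite -mulrBr normrM.
have c1 : 0 < `|c| + 1 by rewrite ltr_wpDl.
apply: (@le_trans _ _ ((`|c| + 1) * (e / (`|c| + 1)))).
  by apply: ler_pM => //; [rewrite lerDl|exact: hV].
by rewrite mulrC divfK// gt_eqF.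
Qed.

Lemma polynomial_abs_approx k W : polynomial W -> polynomial (fun p => abs_approx k (W p)).
Proof.
move=> pW; elim: k => [|k ih] /=; first exact: polynomialC.
apply: polynomialD => //; apply: polynomialM; first exact: polynomialC.
by apply: polynomialB; exact: polynomialM.
Qed.

Lemma poly_approx_norm f : poly_approx f -> poly_approx (fun p => `|f p|).
Proof.
move=> af e e0; have e2 : 0 < e / 2 by rewrite divr_gt0.
have [W pW hW] := af _ e2.
have [B B0 hB] := within_continuous_bounded (continuous_subspaceT (polynomial_continuous pW)).
pose k := Num.bound (4 * B / e).
exists (fun p => B * abs_approx k (B^-1 * W p)).
  apply: polynomialM; first exact: polynomialC.
  by apply: polynomial_abs_approx; apply: polynomialM => //; exact: polynomialC.
move=> p Kp.
have t1 : `|B^-1 * W p| <= 1.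
  by rewrite normrM gtr0_norm ?invr_gt0// mulrC ler_pdivrMr// mul1r hB.
have h1 : `| `|W p| - B * abs_approx k (B^-1 * W p)| <= e / 2.
  have -> : `|W p| = B * `|B^-1 * W p|.
    by rewrite normrM gtr0_norm ?invr_gt0// mulrA divff ?mul1r// gt_eqF.
  rewrite -mulrBr normrM (gtr0_norm B0).
  apply: (@le_trans _ _ (B * (2 / k.+1%:R))).
    by apply: ler_wpM2l (abs_approx_error k t1); exact: ltW.
  rewrite mulrA ler_pdivrMr ?ltr0n//.
  have : 4 * B / e < k.+1%:R.
    have : 4 * B / e < k%:R.
      by have := archi_boundP (_ : 0 <= 4 * B / e); apply; rewrite divr_ge0// ?mulr_ge0// ltW.
    by move=> /lt_trans; apply; rewrite ltr_nat.
  rewrite ltr_pdivrMr// => h; lra.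
have h2 : `| `|f p| - `|W p| | <= e / 2 by rewrite (le_trans (ler_dist_dist _ _))// hW.
rewrite -(subrK `|W p| `|f p|) -addrA (le_trans (ler_normD _ _))//; lra.
Qed.

Lemma poly_approx_min f g : poly_approx f -> poly_approx g ->
  poly_approx (fun p => Num.min (f p) (g p)).
Proof.
move=> af ag.
rewrite (_ : (fun _ => _) = fun p => 2^-1 * ((f p + g p) + -1 * `|f p + -1 * g p|)).
  apply: poly_approxZ; apply: poly_approxD; first exact: poly_approxD.
  by apply: poly_approxZ; apply: poly_approx_norm; apply: poly_approxD => //; exact: poly_approxZ.
apply/funext => p; rewrite !mulN1r; case: (leP (f p) (g p)) => h.
  by rewrite ler0_norm ?subr_le0//; field.
by rewrite gtr0_norm ?subr_gt0//; field.
Qed.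

(** The member at [j0] serves only as the value on the empty list, since a
    minimum has no neutral element. *)
Definition inf_family (J : Type) (r : seq J) (j0 : J) (F : J -> Cspace R m -> R) p : R :=
  foldr (fun j a => Num.min (F j p) a) (F j0 p) r.

Lemma poly_approx_inf_family (J : Type) (r : seq J) (j0 : J) F :
  (forall j, polynomial (F j)) -> poly_approx (inf_family r j0 F).
Proof.
move=> pF; elim: r => [|j r ih]; first exact: (poly_approx_polynomial (pF j0)).
exact: (poly_approx_min (poly_approx_polynomial (pF j)) ih).
Qed.

Lemma inf_family_ge (J : eqType) (r : seq J) (j0 : J) F p (a : R) :
  a <= F j0 p -> (forall j, j \in r -> a <= F j p) -> a <= inf_family r j0 F p.
Proof.
move=> a0; elim: r => [//|j r ih] h; rewrite /inf_family /= le_min h ?mem_head//=.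
by apply: ih => k kr; apply: h; rewrite in_cons kr orbT.
Qed.

Lemma inf_family_le (J : eqType) (r : seq J) (j0 : J) F p j :
  j \in r -> inf_family r j0 F p <= F j p.
Proof.
elim: r => [//|k r ih]; rewrite in_cons => /predU1P[->|jr] /=.
  by rewrite /inf_family /= ge_min lexx.
by rewrite /inf_family /= ge_min ih ?orbT.
Qed.

(** For C_y large, the polynomial F_y x = g y + C_y |x - y|^2 is above g - e/3 on
    all of K, by continuity of g at y near y and by boundedness of g elsewhere;
    and it is below g + 2e/3 near y.  By compactness the minimum of finitely many
    F_y is within 2e/3 of g, and such a minimum is a uniform limit of polynomials
    because the absolute value is. *)
Lemma weierstrass g : {within K, continuous g} -> poly_approx g.
Proof.
move=> cg e e0.
have [[y0 Ky0]|K0] := pselect (K !=set0); last first.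
  exists (fun=> 0); first exact: polynomialC.
  by move=> p Kp; exfalso; apply: K0; exists p.
pose e3 := e / 3; have e30 : 0 < e3 by rewrite divr_gt0.
have [M M0 hM] := within_continuous_bounded cg.
have sq y : polynomial (fun x => dot (x - y) (x - y)).
  apply: polynomial_sum => i; have h : polynomial (fun p => crd i (p - y)).
    rewrite (_ : (fun _ => _) = fun p => crd i p - crd i y).
      by apply: polynomialB; [exact: polynomial_crd|exact: polynomialC].
    by apply/funext => p; rewrite -[- y]scaleN1r crdD crdZ mulN1r.
  exact: polynomialM.
have /choice[CD hCD] : forall y, exists CD : R * R, K y ->
    [/\ 0 < CD.2,
      forall x, K x -> g x - e3 <= g y + CD.1 * dot (x - y) (x - y) &
      forall x, K x -> dot (x - y) (x - y) < CD.2 ->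
        g y + CD.1 * dot (x - y) (x - y) <= g x + 2 * e3].
  move=> y; have [Ky|nKy] := pselect (K y); last by exists (0, 0) => /nKy.
  have := (subspace_continuousP _ _).1 cg y Ky.
  move=> /cvgrPdist_lt/(_ _ e30) /nbhs_dot[d d0].
  rewrite /from_subspace => hd.
  have [C C0 CE] : exists2 C : R, 0 < C & 2 * M = C * d.
    by exists (2 * M / d); [rewrite divr_gt0// mulr_gt0|rewrite divfK// gt_eqF].
  exists (C, Num.min d (e3 / C)) => _ /=; split.
  - by rewrite lt_min d0 divr_gt0.
  - move=> x Kx; have [xd|xd] := ltP (dot (x - y) (x - y)) d.
      have := hd x xd Kx; rewrite ltr_distlC => /andP[h1 h2].
      have : 0 <= C * dot (x - y) (x - y) by rewrite mulr_ge0 ?dot_ge0 ?ltW.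
      by lra.
    have h : 2 * M <= C * dot (x - y) (x - y).
      by rewrite CE ler_pM2l.
    have := hM x Kx; have := hM y Ky; rewrite !ler_norml => /andP[? ?] /andP[? ?].
    by lra.
  - move=> x Kx; rewrite lt_min => /andP[xd xe].
    have := hd x xd Kx; rewrite ltr_distlC => /andP[h1 h2].
    by move: xe; rewrite ltr_pdivlMr// => xe; lra.
pose F y x := g y + (CD y).1 * dot (x - y) (x - y).
have pF y : polynomial (F y).
  by apply: polynomialD; [exact: polynomialC|apply: polynomialM => //; exact: polynomialC].
pose O y := [set x | dot (x - y) (x - y) < (CD y).2].
have := compact_finite_cover cK; move=> /(_ _ K O) [|x Kx|D DK KD].
- move=> y _; rewrite (_ : O y = (fun x => dot (x - y) (x - y)) @^-1` [set t | t < (CD y).2])//.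
  apply: open_comp; last exact: open_lt.
  by move=> x _; exact: polynomial_continuous.
- exists x => //; rewrite /O /=.
  have [? _ _] := hCD x Kx.
  rewrite subrr /dot big1// => i _.
  by rewrite -(scale0r (0 : Cspace R m)) crdZ !mul0r.
have [W pW hW] := poly_approx_inf_family (enum_fset D) y0 pF e30.
exists W => // p Kp; have := hW p Kp.
have lo : g p - e3 <= inf_family (enum_fset D) y0 F p.
  apply: inf_family_ge; first by have [_ h _] := hCD y0 Ky0; exact: h.
  move=> y yD; have Ky : K y := set_mem (DK y yD).
  by have [_ h _] := hCD y Ky; exact: h.
have [y yD yp] := KD p Kp.
have hi : inf_family (enum_fset D) y0 F p <= g p + 2 * e3.
  apply: le_trans (inf_family_le y0 F p (yD : y \in enum_fset D)) _.
  have Ky : K y := set_mem (DK y yD).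
  by have [_ _ h] := hCD y Ky; exact: h.
rewrite /e3 in lo hi *; rewrite !ler_distl => /andP[? ?]; apply/andP; split; lra.
Qed.

End Weierstrass.

(** * Powers of positive polynomials are smooth *)

Section SmoothPowers.
Variables (R : realType) (m : nat).
Implicit Types (f g : Cspace R m -> R) (p v : Cspace R m) (i j : dirs m).

Lemma is_derive_line f p v (df : R) :
  is_derive p v f df <-> is_derive 0 (1 : R) (fun h : R => f (h *: v + p)) df.
Proof.
have e : 'D_v f p = 'D_(1 : R) (fun h : R => f (h *: v + p)) 0.
  rewrite /derive; set g1 := fun h => h^-1 *: _; set g2 := fun h => h^-1 *: _.
  suff -> : g1 = g2 by [].
  by rewrite funeqE /g1 /g2 => h /=; rewrite addr0 scale0r add0r [_%:A]mulr1.
split=> -[d1 d2]; split.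
- exact: (derivable1P f p v).1 d1.
- by rewrite -e.
- exact: (derivable1P f p v).2 d1.
- by rewrite e.
Qed.

Lemma is_derive_comp1 (g : R -> R) f p v (dg df : R) :
  is_derive (f p) (1 : R) g dg -> is_derive p v f df ->
  is_derive p v (fun x => g (f x)) (dg * df).
Proof.
move=> hg /is_derive_line hf; apply/is_derive_line.
apply: is_derive1_comp => //.
by rewrite scale0r add0r.
Qed.

Lemma continuous_comp1 (g : R -> R) f p (dg : R) : {for p, continuous f} ->
  is_derive (f p) (1 : R) g dg -> {for p, continuous (fun x => g (f x))}.
Proof.
move=> cf [dgp _]; apply: (@continuous_comp _ _ _ f g) => //.
by apply: differentiable_continuous; exact/derivable1_diffP.
Qed.

Lemma continuous_powR_comp f p (b : R) : {for p, continuous f} -> 0 < f p ->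
  {for p, continuous (fun x => f x `^ b)}.
Proof.
by move=> cf fp; apply: continuous_comp1 (fun y => y `^ b) _ _ _ cf (is_derive1_powR b fp).
Qed.

Variable Q : Cspace R m -> R.
Hypothesis pQ : polynomial Q.

(** This class is stable under partial derivatives where Q is positive, because
    differentiating P * Q^b produces terms of the same form with exponents b and
    b - 1; smoothness follows at once. *)
Inductive power_poly : (Cspace R m -> R) -> Prop :=
| power_poly_mul P b : polynomial P -> power_poly (fun p => P p * Q p `^ b)
| power_polyD f g : power_poly f -> power_poly g -> power_poly (fun p => f p + g p).

Definition positive_locus : set (Cspace R m) := [set p | 0 < Q p].

Lemma open_positive_locus : open positive_locus.
Proof.
rewrite (_ : positive_locus = Q @^-1` [set t | 0 < t])//.
apply: open_comp; last exact: open_gt.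
by move=> x _; exact: polynomial_continuous.
Qed.

Lemma power_poly_continuous f p : power_poly f -> positive_locus p ->
  {for p, continuous f}.
Proof.
move=> ff Qp; elim: ff => {f} [P b pP|f g _ cf _ cg]; last exact: continuousD.
apply: continuousM; first exact: polynomial_continuous.
by apply: continuous_powR_comp => //; exact: polynomial_continuous.
Qed.

Lemma polynomial_is_derive f i p : polynomial f -> is_derive p (bas R i) f (partial i f p).
Proof. by move=> [d df]; exact: poly_lt_is_derive df. Qed.

Lemma polynomial_partial f i : polynomial f -> polynomial (partial i f).
Proof. by move=> [d df]; exists d.-1; exact: poly_lt_partial. Qed.

Lemma is_derive_powR i p (b : R) : positive_locus p ->
  is_derive p (bas R i) (fun p => Q p `^ b) (b * Q p `^ (b - 1) * partial i Q p).
Proof.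
by move=> Qp; apply: (is_derive_comp1 (is_derive1_powR b Qp)); exact: polynomial_is_derive.
Qed.

Lemma power_poly_derive f i : power_poly f -> exists2 g, power_poly g &
  forall p, positive_locus p -> is_derive p (bas R i) f (g p).
Proof.
elim=> {f} [P b pP|f g _ [f' pf' hf] _ [g' pg' hg]]; last first.
  exists (fun p => f' p + g' p); first exact: power_polyD.
  by move=> p Qp; exact: (is_deriveD (hf p Qp) (hg p Qp)).
exists (fun p => (b * P p * partial i Q p) * Q p `^ (b - 1) + partial i P p * Q p `^ b).
  apply: power_polyD; apply: power_poly_mul; last exact: polynomial_partial.
  apply: polynomialM; last exact: polynomial_partial.
  by apply: polynomialM => //; exact: polynomialC.
move=> p Qp.
have h := is_deriveM (polynomial_is_derive i p pP) (is_derive_powR i b Qp).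
apply: (is_derive_eq h).
rewrite -[X in X + _]/(P p * _) -[X in _ + X]/(_ * partial i P p); ring.
Qed.

(** Stated for functions that agree with the class on the open set only: outside
    that set, the derivatives of a member of the class need not have its form. *)
Lemma power_poly_Ck k f g : power_poly g -> (forall p, positive_locus p -> f p = g p) ->
  Ck_on k positive_locus f.
Proof.
have near_eq f' g' p : (forall p, positive_locus p -> f' p = g' p) -> positive_locus p ->
    \near p, g' p = f' p :> R.
  move=> fg Qp; near=> x; rewrite fg//; near: x.
  exact: open_nbhs_nbhs (conj open_positive_locus Qp).
have cont f' g' p : power_poly g' -> (forall p, positive_locus p -> f' p = g' p) ->
    positive_locus p -> {for p, continuous f'}.
  move=> pg fg Qp; rewrite /prop_for /continuous_at fg//.
  by apply: cvg_trans (power_poly_continuous pg Qp); apply: near_eq_cvg; exact: near_eq.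
elim: k f g => [|k ih] f g pg fg /=.
  by move=> p Qp; exact: cont pg fg Qp.
split; first by move=> p Qp; exact: cont pg fg Qp.
have D i : (forall p, positive_locus p -> derivable f p (bas R i)) /\
    Ck_on k positive_locus ('D_(bas R i) f).
  have [g' pg' hg'] := power_poly_derive i pg.
  have df p : positive_locus p -> is_derive p (bas R i) f (g' p).
    by move=> Qp; apply: near_eq_is_derive (near_eq _ _ _ fg Qp) (hg' p Qp).
  split; first by move=> p /df[].
  by apply: (ih _ g') => // p /df[].
move=> j; have [dx cx] := D (inl j); have [dy cy] := D (inr j).
exact: (And4 dx dy cx cy).
Unshelve. all: by end_near. Qed.

Lemma power_poly_smooth f : power_poly f -> smooth_on positive_locus f.
Proof. by move=> pf k; exact: power_poly_Ck pf _. Qed.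

End SmoothPowers.

(** * The bubbles *)

Lemma polynomial_dot (R : realType) m (u : Cspace R m) : polynomial (dot u).
Proof.
apply: polynomial_sum => i; apply: polynomialM; first exact: polynomialC.
exact: polynomial_crd.
Qed.

Section Bubble.
Variables (R : realType) (n : nat) (q : Cspace R n.+1) (a : R).
Hypothesis Sq : sphere R n q.
Implicit Types p : Cspace R n.+1.

(** The squared modulus of 1 - a <p, q>: the two inner products are the real and
    imaginary parts of the Hermitian product of p and q. *)
Definition bubble_base p : R :=
  1 - 2 * a * dot q p + a ^+ 2 * (dot q p ^+ 2 + dot (rot q) p ^+ 2).

Local Notation Q := bubble_base.
Local Notation U := (positive_locus Q).

Lemma polynomial_bubble_base : polynomial Q.
Proof.
apply: polynomialD.
  apply: polynomialB; first exact: polynomialC.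
  by apply: polynomialM; [exact: polynomialC|exact: polynomial_dot].
apply: polynomialM; first exact: polynomialC.
by apply: polynomialD; apply: polynomialM; exact: polynomial_dot.
Qed.

Definition bubble_grad p : Cspace R n.+1 :=
  (2 * a * (a * dot q p - 1)) *: q + (2 * a ^+ 2 * dot (rot q) p) *: rot q.

Lemma partial_bubble_base i p : partial i Q p = crd i (bubble_grad p).
Proof.
rewrite partialE crdD !crdZ.
have h1 := is_derive_dot q (bas R i) p.
have h2 := is_derive_dot (rot q) (bas R i) p.
have h := is_deriveD (is_deriveD (is_derive_cst (1 : R) p (bas R i))
  (is_deriveZ (- (2 * a)) h1))
  (is_deriveZ (a ^+ 2) (is_deriveD (is_deriveX 2 h1) (is_deriveX 2 h2))).
rewrite (_ : Q = cst 1 + (- (2 * a)) \*: dot q +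
   a ^+ 2 \*: (dot q ^+ 2 + dot (rot q) ^+ 2)); last first.
  by apply/funext => x; rewrite /Q /= -mulNr.
have [_ ->] := h.
rewrite !dot_bas /=.
rewrite -[_ *: crd i q]/(_ * crd i q) -[_ *: (_ + _)]/(_ * (_ + _)).
rewrite -![(_ * _ ^+ _) *: _]/((_ * _ ^+ _) * _).
ring.
Qed.

Lemma partial_partial_bubble_base i j p : partial i (partial j Q) p =
  2 * a ^+ 2 * (crd i q * crd j q + crd i (rot q) * crd j (rot q)).
Proof.
have -> : partial j Q = fun p => (2 * a ^+ 2 * crd j q) * dot q p +
   (2 * a ^+ 2 * crd j (rot q)) * dot (rot q) p + - (2 * a * crd j q).
  by apply/funext => x; rewrite partial_bubble_base crdD !crdZ; ring.
rewrite partialE.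
have h1 := is_deriveZ (2 * a ^+ 2 * crd j q) (is_derive_dot q (bas R i) p).
have h2 := is_deriveZ (2 * a ^+ 2 * crd j (rot q)) (is_derive_dot (rot q) (bas R i) p).
have [_ ->] := is_deriveD (is_deriveD h1 h2) (is_derive_cst (- (2 * a * crd j q)) p (bas R i)).
rewrite !dot_bas -![_ *: _]/(_ * _); ring.
Qed.

Section Power.
Variable b : R.

Let F p := Q p `^ b.

Lemma partial_bubble_power i p : U p ->
  partial i F p = b * Q p `^ (b - 1) * partial i Q p.
Proof.
move=> Up; rewrite [LHS]partialE.
by have [_] := is_derive_powR polynomial_bubble_base i b Up.
Qed.

Lemma is_derive_partial_bubble_power i j p : U p -> is_derive p (bas R i) (partial j F)
  (b * (b - 1) * Q p `^ (b - 2) * (partial i Q p * partial j Q p) +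
   b * Q p `^ (b - 1) * partial i (partial j Q) p).
Proof.
move=> Up.
have pQ := polynomial_bubble_base.
have e : \near p, b * Q p `^ (b - 1) * partial j Q p = partial j F p.
  near=> x; rewrite partial_bubble_power//; near: x.
  exact: open_nbhs_nbhs (conj (open_positive_locus pQ) Up).
apply: near_eq_is_derive e _.
have h := is_deriveM (is_deriveZ b (is_derive_powR pQ i (b - 1) Up))
   (polynomial_is_derive i p (polynomial_partial j pQ)).
apply: (is_derive_eq h).
rewrite (_ : b - 1 - 1 = b - 2); last by ring.
rewrite addrC -[X in X + _]/(partial j Q p * (b * _)) -[X in _ + X]/((b * _) * _).
ring.
Unshelve. all: by end_near. Qed.

Lemma partial_partial_bubble_power i j p : U p -> partial i (partial j F) p =
  b * (b - 1) * Q p `^ (b - 2) * (partial i Q p * partial j Q p) +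
   b * Q p `^ (b - 1) * partial i (partial j Q) p.
Proof.
by move=> Up; rewrite [LHS]partialE; have [_] := is_derive_partial_bubble_power i j Up.
Qed.

Lemma twice_derivable_bubble_power : twice_derivable_on U F.
Proof.
move=> p Up; split=> [i|i j].
  by have [] := is_derive_powR polynomial_bubble_base i b Up.
by have [] := is_derive_partial_bubble_power j i Up.
Qed.

End Power.

(** Write h + ik for the Hermitian product of p and q, r = h^2 + k^2 and b = -n/2.
    The Hessian of Q^b is a multiple of the square of the gradient of Q plus a
    multiple of the projection on the complex line of q.  On the complex
    orthogonal complement of p their traces are proportional to
    4 a^2 (1 - r) Q and 4 a^2 (1 - r), while the radial derivative of Q is
    -2 a h + 2 a^2 r.  For b = -n/2 the terms add up to a multiple of
    a^2 - 2 a h + a^2 r, that is, of Q - 1 + a^2. *)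
Lemma bubble_equation p : sphere R n p -> U p ->
  conf_lap (fun p => Q p `^ (- n%:R / 2)) p =
  n%:R ^+ 2 / 4 * (1 - a ^+ 2) * Q p `^ (- n%:R / 2 - 1).
Proof.
move=> Sp Up; set b := - n%:R / 2.
have qq := (sphere_dot q).1 Sq; have pp := (sphere_dot p).1 Sp.
have rr : dot (rot q) (rot q) = 1 by rewrite dot_rot2.
have qr : dot q (rot q) = 0 := dot_rot q.
have rq : dot (rot q) q = 0 by rewrite dotC.
pose g := bubble_grad p; pose x := Q p `^ (b - 2).
have Q0 : Q p != 0 by rewrite gt_eqF.
have xQ : Q p `^ (b - 1) = x * Q p.
  rewrite (_ : b - 1 = b - 2 + 1); last by ring.
  by rewrite powRD ?Q0 ?implybT// powRr1// ltW.
have xQQ : Q p `^ b = x * Q p ^+ 2.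
  by rewrite (_ : b = b - 1 + 1); [rewrite powRD ?Q0 ?implybT// powRr1 ?ltW// xQ; ring|ring].
pose A := b * (b - 1) * x; pose B := b * (x * Q p).
have HE i j : partial i (partial j (fun p => Q p `^ b)) p =
    A * (crd i g * crd j g) + 2 * a ^+ 2 * B * (crd i q * crd j q)
    + 2 * a ^+ 2 * B * (crd i (rot q) * crd j (rot q)).
  rewrite partial_partial_bubble_power// !partial_bubble_base partial_partial_bubble_base.
  by rewrite -/g xQ -/x /A /B; ring.
have quad u : \sum_i \sum_j (crd i u * crd j u) * partial i (partial j (fun p => Q p `^ b)) p =
    A * dot u g ^+ 2 + 2 * a ^+ 2 * B * (dot u q ^+ 2 + dot u (rot q) ^+ 2).
  rewrite mulrDr addrA -!sum_rank_one !mulr_sumr -!big_split /=.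
  apply: eq_bigr => i _; rewrite !mulr_sumr -!big_split /=.
  by apply: eq_bigr => j _; rewrite HE; ring.
have tr : \sum_i partial i (partial i (fun p => Q p `^ b)) p =
    A * dot g g + 2 * a ^+ 2 * B * (dot q q + dot (rot q) (rot q)).
  rewrite mulrDr addrA /dot !mulr_sumr -!big_split /=.
  by apply: eq_bigr => i _; rewrite HE; ring.
have gr : \sum_i crd i p * partial i (fun p => Q p `^ b) p = B * dot p g.
  rewrite mulr_sumr; apply: eq_bigr => i _.
  by rewrite partial_bubble_power// partial_bubble_base -/g xQ /B; ring.
rewrite /conf_lap /sublap tr gr xQQ.
under [X in _ - X - _]eq_bigr do under eq_bigr do rewrite mulrDl.
under [X in _ - X - _]eq_bigr do rewrite big_split.
rewrite big_split /= !quad.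
rewrite /g /bubble_grad !dotDr !dotZr !dotDl !dotZl qq rr qr rq.
rewrite (dot_rotl p q) !(dot_rotrot p q) ![dot p _]dotC xQ /A /B /Q /b.
by field.
Qed.

(** Bessel's inequality for the orthonormal pair q, [rot q]. *)
Lemma dot_sphere_le1 p : sphere R n p -> dot q p ^+ 2 + dot (rot q) p ^+ 2 <= 1.
Proof.
move=> /sphere_dot pp; have qq := (sphere_dot q).1 Sq.
have := dot_ge0 (p + (- dot q p) *: q + (- dot (rot q) p) *: rot q).
rewrite !(dotDl, dotDr, dotZl, dotZr) dot_rot2 qq pp dot_rot [dot (rot q) q]dotC dot_rot.
rewrite [dot p q]dotC [dot p (rot q)]dotC; lra.
Qed.

Lemma bubble_base_le4 p : 0 <= a <= 1 -> sphere R n p -> Q p <= 4.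
Proof.
move=> /andP[a0 a1] Sp; have := dot_sphere_le1 Sp; rewrite /Q.
move: (dot q p) (dot (rot q) p) => h k hk.
have h1 : -1 <= h by have := sqr_ge0 (1 + h); have := sqr_ge0 k; nra.
nra.
Qed.

Lemma bubble_base_ge p c : 0 <= a -> 0 <= c <= 1 - a * dot q p -> c ^+ 2 <= Q p.
Proof.
move=> a0 /andP[c0 ch].
have -> : Q p = (1 - a * dot q p) ^+ 2 + (a * dot (rot q) p) ^+ 2 by rewrite /Q; ring.
have h : 0 <= 1 - a * dot q p by exact: le_trans ch.
rewrite -[X in X <= _]addr0 lerD ?sqr_ge0// ler_pXn2r ?nnegrE//.
Qed.

Lemma sphere_positive_locus p : 0 <= a < 1 -> sphere R n p -> U p.
Proof.
move=> /andP[a0 a1] Sp; rewrite /positive_locus /=.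
apply: (@lt_le_trans _ _ ((1 - a) ^+ 2)); first by rewrite exprn_gt0// subr_gt0.
apply: bubble_base_ge => //; rewrite subr_ge0 (ltW a1)/=.
have := dot_sphere_le1 Sp; move: (dot q p) (dot (rot q) p) => h k hk.
have h1 : h <= 1 by have := sqr_ge0 (h - 1); have := sqr_ge0 k; nra.
nra.
Qed.

End Bubble.

(** * Curvature of a real conformal factor, and estimates *)

Section WebsterReal.
Local Open Scope complex_scope.

Lemma webster_scal_real (R : realType) (n : nat) (V : Cspace R n.+1 -> R)
    (p : Cspace R n.+1) : (0 < n)%N ->
  (forall i j, derivable (partial i V) p (bas R j)) ->
  (forall i j, partial i (partial j V) p = partial j (partial i V) p) ->
  webster_scal V p = (V p `^ (- ((n%:R + 2) / n%:R)) *
    (2 * (n%:R + 1) / n%:R * conf_lap V p))%:C.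
Proof.
move=> n0 dV sV; rewrite /webster_scal sublaplacian_real// /conf_lap.
move: (sublap V p) (V p) (_ `^ _) => L v c; rewrite [RHS]rmorphM; congr (_ * _).
have nC : n%:R != 0 :> R[i] by rewrite pnatr_eq0 -lt0n.
rewrite !(rmorphM, rmorphB, rmorphD, fmorphV, rmorphXn, rmorph_nat, rmorph1) /=.
by field.
Qed.

End WebsterReal.

Section Estimates.
Variable R : realType.

(** Soft thresholding: x is moved by d towards 0, and stops there. *)
Definition soft (d x : R) : R := x - 2^-1 * (`|x + d| - `|x - d|).

Lemma soft_dist d x : 0 <= d -> `|soft d x - x| <= d.
Proof.
move=> d0; rewrite /soft addrC addKr normrN normrM gtr0_norm ?invr_gt0//.
have := ler_dist_dist (x + d) (x - d).
rewrite (_ : x + d - (x - d) = 2 * d); last by ring.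
by rewrite [X in _ <= X]ger0_norm ?mulr_ge0//; lra.
Qed.

Lemma soft_eq0 d x : `|x| <= d -> soft d x = 0.
Proof.
rewrite ler_norml /soft => /andP[h1 h2].
by rewrite ger0_norm ?ler0_norm; lra.
Qed.

Lemma powR_near1 (r e : R) : 0 < e -> exists2 th : R, 0 < th < 1 &
  forall t, `|t| <= th -> `|(1 + t) `^ r - 1| <= e.
Proof.
move=> e0.
have c1 : {for (1 : R), continuous (fun x => x `^ r)}.
  apply: differentiable_continuous; apply/derivable1_diffP.
  by have [] := is_derive1_powR r (@ltr01 R).
move: c1 => /cvgrPdist_le/(_ _ e0); rewrite powR1 => /nbhs_ballP[d /= d0 hd].
exists (Num.min (d / 2) (2^-1)).
  apply/andP; split; first by rewrite lt_min; apply/andP; split; lra.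
  by rewrite gt_min; apply/orP; right; lra.
move=> t; rewrite le_min => /andP[td _]; rewrite distrC.
apply: hd; rewrite /ball /= opprD addrA subrr sub0r normrN.
by apply: le_lt_trans td _; lra.
Qed.

Lemma powR_antitone (x y e : R) : 0 < x -> x <= y -> e <= 0 -> y `^ e <= x `^ e.
Proof.
move=> x0 xy e_le0; have y_gt0 : 0 < y by exact: lt_le_trans xy.
rewrite -[e]opprK !(powRN _ (- e)) lef_pV2 ?posrE ?powR_gt0//.
by apply: ge0_ler_powR => //; rewrite ?nnegrE ?oppr_ge0 ?(ltW x0) ?(ltW y_gt0).
Qed.

(** To be used with z = (1 + w/U)^(-(n+2)/n), k = K0, b = Rbar and e' the relative
    error in the linear equation. *)
Lemma curvature_estimate (z k e' b M eps : R) : 0 < eps -> 0 < M ->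
  `|z - 1| <= Num.min 1 (eps / (4 * M)) -> `|k| <= M -> `|k - b| <= eps / 4 ->
  `|e'| <= eps / 8 -> `|z * (k + e') - b| <= 3 / 4 * eps.
Proof.
move=> eps0 M0; rewrite le_min => /andP[z1 zM] kM kb e8.
rewrite (_ : _ - b = (z - 1) * k + ((k - b) + z * e')); last by ring.
apply: le_trans (ler_normD _ _) _.
have h1 : `|(z - 1) * k| <= eps / 4.
  rewrite normrM; apply: (@le_trans _ _ (eps / (4 * M) * M)); first exact: ler_pM.
  by rewrite le_eqVlt; apply/orP; left; apply/eqP; field; rewrite gt_eqF.
have h2 : `|z * e'| <= eps / 4.
  rewrite normrM; apply: (@le_trans _ _ (2 * (eps / 8))); last by lra.
  apply: ler_pM => //; rewrite -(subrK 1 z) (le_trans (ler_normD _ _))// normr1; lra.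
have := ler_normD (k - b) (z * e'); lra.
Qed.

End Estimates.

Section ApproximateSolution.
Variables (R : realType) (n : nat).
Hypothesis n_gt0 : (0 < n)%N.

(** The bound on w involves g only through a bound of |g|, which is what keeps w
    small when the bubble concentrates. *)
Lemma approximate_solution (g : Cspace R n.+1 -> R) (G eta : R) :
  {within sphere R n, continuous g} -> (forall p, sphere R n p -> `|g p| <= G) -> 0 < eta ->
  exists w, [/\ polynomial w,
    forall p, sphere R n p -> `|conf_lap w p - g p| <= eta &
    forall p, sphere R n p -> `|w p| <= 4 / n%:R ^+ 2 * (G + eta)].
Proof.
move=> cg gG eta0.
have [P [d dP] hP] := weierstrass (@sphere_compact R n) cg eta0.
have [w dw wP] := conf_lap_surj n_gt0 dP.
have wg p : sphere R n p -> `|conf_lap w p - g p| <= eta.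
  by move=> Sp; rewrite wP// distrC hP.
exists w; split=> //; first by exists d.
apply: (conf_lap_bound n_gt0 dw) => p Sp.
rewrite -(subrK (g p) (conf_lap w p)) addrC (le_trans (ler_normD _ _))//.
by apply: lerD; [exact: gG|exact: wg].
Qed.

End ApproximateSolution.

(** The scale s is chosen so that s^(-2/N) = 1/C; the exponents are such that
    u^(-(N+2)/N) = 1/Y. *)
Lemma power_scaling (R : realType) (N C s u t x Y b : R) :
  0 < N -> 0 < C -> 0 < x -> 0 < 1 + t -> b = - N / 2 -> s = C `^ (N / 2) ->
  u = x `^ b -> Y = x `^ (b - 1) ->
  s * (s * (u * (1 + t))) `^ (- ((N + 2) / N)) =
  (1 + t) `^ (- ((N + 2) / N)) / (C * Y).
Proof.
move=> N0 C0 x0 t0 bE -> -> ->.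
have NN : N != 0 by rewrite gt_eqF.
rewrite !powRM ?mulr_ge0 ?powR_ge0 ?(ltW t0)// -!powRrM.
rewrite (_ : b * - ((N + 2) / N) = - (b - 1)); last by rewrite bE; field.
rewrite (_ : N / 2 * - ((N + 2) / N) = - 1 - N / 2); last by field.
rewrite powRN powRB ?(gt_eqF C0) ?implybT// powR_inv1 ?ltW//.
have h1 : C `^ (N / 2) != 0 by rewrite gt_eqF// powR_gt0.
have h2 : x `^ (b - 1) != 0 by rewrite gt_eqF// powR_gt0.
by field; rewrite h1 h2 gt_eqF.
Qed.

(** * Density of curvature functions *)

Lemma continuous_soft (R : realType) (d : R) : continuous (soft d).
Proof.
move=> x; apply: cvgB; first exact: cvg_id.
apply: cvgM; first exact: cvg_cst.
apply: cvgB; apply: cvg_norm; [apply: cvgD|apply: cvgB]; try exact: cvg_cst; exact: cvg_id.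
Qed.

(** By continuity f is within d of f q in some ball around q, where thresholding
    gives 0.  Outside the ball the real part h of the Hermitian product with q is
    bounded away from 1, so 1 - a h is bounded below uniformly in a. *)
Lemma soft_localized (R : realType) (n : nat) (f : Cspace R n.+1 -> R) (q : Cspace R n.+1) (d : R) :
  0 < d -> sphere R n q -> {within sphere R n, continuous f} ->
  exists2 c, 0 < c & forall p a, sphere R n p -> 0 <= a <= 1 ->
    soft d (f p - f q) = 0 \/ c ^+ 2 <= bubble_base q a p.
Proof.
move=> d0 Sq cf; have := (subspace_continuousP _ _).1 cf q Sq.
move=> /cvgrPdist_lt/(_ _ d0) /nbhs_dot[r r0].
rewrite /from_subspace => hr.
pose c := Num.min 1 (r / 2).
have c0 : 0 < c by rewrite lt_min; apply/andP; split; lra.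
exists c => // p a Sp /andP[a0 a1].
have [pr|pr] := ltP (dot (p - q) (p - q)) r.
  by left; apply: soft_eq0; rewrite distrC ltW// hr.
right; apply: bubble_base_ge => //; rewrite ltW//=.
have : dot (p - q) (p - q) = 2 - 2 * dot q p.
  rewrite -[- q]scaleN1r !(dotDl, dotDr, dotZl, dotZr).
  by rewrite ((sphere_dot q).1 Sq) ((sphere_dot p).1 Sp) [dot p q]dotC; ring.
move=> e; rewrite e in pr.
have [h0|h0] := leP (dot q p) 0.
  by rewrite ge_min; apply/orP; left; rewrite lerBrDr gerDl mulr_ge0_le0.
rewrite ge_min; apply/orP; right; nra.
Qed.

Theorem corollary1p1 (R : realType) (n : nat) (n_ge1 : (1 <= n)%N)
    (Rbar : Cspace R n.+1 -> R)
    (Rbar_cont : {within sphere R n, continuous Rbar})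
    (Rbar_pos : exists2 q, sphere R n q & 0 < Rbar q)
    (eps : R) (eps_gt0 : 0 < eps) :
  exists Rbar' : Cspace R n.+1 -> R,
    [/\ {within sphere R n, continuous Rbar'},
        (C0norm (fun p => Rbar' p - Rbar p)%R < eps%:E)%E &
        exists v : Cspace R n.+1 -> R,
          [/\ smooth_on_sphere v,
              (forall p, sphere R n p -> 0 < v p) &
              is_webster_scalar_curvature v Rbar']].
Proof.
have [q Sq Rq0] := Rbar_pos; pose Rq := Rbar q.
pose N : R := n%:R; have N0 : 0 < N by rewrite ltr0n.
pose b : R := - N / 2.
have [M0 M00 hM0] := within_continuous_bounded (@sphere_compact R n) Rbar_cont.
pose d := eps / 4; have d0 : 0 < d by rewrite divr_gt0.
pose M := M0 + d; have M_gt0 : 0 < M by rewrite addr_gt0.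
(* K0 = Rq + D is the modified target curvature. *)
pose D p := soft d (Rbar p - Rq).
have K0R p : `|Rq + D p - Rbar p| <= d.
  by rewrite (_ : _ - _ = D p - (Rbar p - Rq)); [exact: soft_dist (ltW d0)|ring].
have K0M p : sphere R n p -> `|Rq + D p| <= M.
  move=> Sp; rewrite -(subrK (Rbar p) (Rq + D p)) (le_trans (ler_normD _ _))// addrC.
  by apply: lerD; [exact: hM0|exact: K0R].
have DM p : sphere R n p -> `|D p| <= 2 * M.
  move=> Sp; rewrite -(addKr Rq (D p)) (le_trans (ler_normD _ _))// normrN.
  by have := hM0 q Sq; have := K0M p Sp; rewrite -/Rq /M; lra.
have [c c0 hc] := soft_localized d0 Sq Rbar_cont.
pose u0 : R := 4 `^ b; have u00 : 0 < u0 by rewrite powR_gt0.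
pose y0 : R := 4 `^ (b - 1); have y00 : 0 < y0 by rewrite powR_gt0.
(* G0 bounds D * U^(1+2/n) for every a; u0 and y0 bound U and U^(1+2/n) from
   below, as Q is at most 4 on the sphere. *)
pose G0 : R := 2 * M * (c ^+ 2) `^ (b - 1).
have G00 : 0 < G0 by rewrite !mulr_gt0// powR_gt0// exprn_gt0.
have e1 : 0 < Num.min 1 (eps / (4 * M)).
  by rewrite lt_min ltr01 divr_gt0// mulr_gt0.
have [th /andP[th0 th1] hth] := powR_near1 (- ((N + 2) / N)) e1.
pose eta := Num.min 1 (eps / 8).
have eta0 : 0 < eta by rewrite lt_min ltr01 divr_gt0.
have [eta1 eta8] : eta <= 1 /\ eta <= eps / 8 by rewrite !ge_min !lexx orbT.
(* tau = 1 - a^2 measures the concentration of the bubble.  It is chosen so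
   that the bound tau * (G0 + y0) / Rq on w makes |w| <= th * U. *)
pose tau := Num.min 1 (th * u0 * Rq / (G0 + y0)).
have Gy : 0 < G0 + y0 by rewrite addr_gt0.
have tau0 : 0 < tau by rewrite lt_min ltr01 divr_gt0// !mulr_gt0.
have tau1 : tau <= 1 by rewrite ge_min lexx.
have tau2 : tau * (G0 + y0) / Rq <= th * u0.
  by rewrite ler_pdivrMr// -ler_pdivlMr// ge_min lexx orbT.
pose a := Num.sqrt (1 - tau).
have a2 : a ^+ 2 = 1 - tau by rewrite sqr_sqrtr// subr_ge0.
have a0 : 0 <= a by rewrite sqrtr_ge0.
have a1 : a < 1 by rewrite -(ltr_pXn2r (_ : 0 < 2)%N)// ?nnegrE// a2 expr1n; lra.
have a01 : 0 <= a < 1 by rewrite a0.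
have a01' : 0 <= a <= 1 by rewrite a0 ltW.
pose Q := bubble_base q a; pose Y p := Q p `^ (b - 1).
have pQ : polynomial Q := polynomial_bubble_base q a.
have Qpos p : sphere R n p -> 0 < Q p by exact: sphere_positive_locus.
have b0 : b <= 0 by rewrite /b; lra.
have b10 : b - 1 <= 0 by lra.
have Uu0 p : sphere R n p -> u0 <= Q p `^ b.
  by move=> Sp; apply: powR_antitone b0; [exact: Qpos|exact: bubble_base_le4].
have Yy0 p : sphere R n p -> y0 <= Y p.
  by move=> Sp; apply: powR_antitone b10; [exact: Qpos|exact: bubble_base_le4].
pose beta := N ^+ 2 / 4 * tau / Rq.
have beta0 : 0 < beta by rewrite divr_gt0// mulr_gt0// divr_gt0// exprn_gt0.
have DY p : sphere R n p -> `|D p * Y p| <= G0.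
  move=> Sp; rewrite normrM (ger0_norm (powR_ge0 _ _)).
  have [D0|cQ] := hc p a Sp a01'; first by rewrite /D D0 normr0 mul0r ltW.
  apply: ler_pM => //; [exact: powR_ge0|exact: DM|].
  by apply: powR_antitone b10; [rewrite exprn_gt0|exact: cQ].
have Y_cont p : sphere R n p -> {for p, continuous Y}.
  by move=> Sp; apply: continuous_powR_comp; [exact: polynomial_continuous|exact: Qpos].
have DY_cont : {within sphere R n, continuous (fun p => beta * (D p * Y p))}.
  move=> p; apply: cvgM; first exact: cvg_cst.
  apply: (@cvgM _ (subspace (sphere R n)) _ _ D Y).
    apply: (@continuous_comp _ _ _ (fun p : subspace (sphere R n) => Rbar p - Rq) (soft d)).
      by apply: cvgB; [exact: Rbar_cont|exact: cvg_cst].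
    exact: continuous_soft.
  apply: (continuous_in_subspaceT (f := Y)) => x xS; apply: Y_cont; exact: set_mem.
have bDY p : sphere R n p -> `|beta * (D p * Y p)| <= beta * G0.
  by move=> Sp; rewrite normrM gtr0_norm// ler_pM2l// DY.
have [w [pw w_eq w_small]] := approximate_solution n_ge1 DY_cont bDY
   (mulr_gt0 (mulr_gt0 eta0 beta0) y00).
have w_th p : sphere R n p -> `|w p| <= th * u0.
  move=> /w_small /le_trans; apply; apply: le_trans tau2.
  have -> : tau * (G0 + y0) / Rq = 4 / N ^+ 2 * (beta * G0 + 1 * beta * y0).
    by rewrite /beta; field; rewrite !gt_eqF.
  rewrite ler_pM2l ?divr_gt0 ?exprn_gt0// lerD2l ler_pM2r// ler_pM2r//.
(* The multiple of the bubble with curvature Rq has s^(-2/n) * C = 1. *)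
pose C := 2 * (N + 1) / N * beta.
have C0 : 0 < C by rewrite mulr_gt0// divr_gt0// mulr_gt0// addr_gt0.
pose s := C `^ (N / 2); have s0 : 0 < s by rewrite powR_gt0.
pose V p := s * Q p `^ b + s * w p.
pose t p := w p / Q p `^ b.
have t_th p : sphere R n p -> `|t p| <= th.
  move=> Sp; have U0 : 0 < Q p `^ b by rewrite powR_gt0 ?Qpos.
  rewrite normrM normfV (gtr0_norm U0) ler_pdivrMr//.
  by rewrite (le_trans (w_th p Sp))// ler_pM2l// Uu0.
have t0 p : sphere R n p -> 0 < 1 + t p.
  by move=> Sp; have := t_th p Sp; rewrite ler_norml => /andP[? _]; lra.
have VE p : sphere R n p -> V p = s * (Q p `^ b * (1 + t p)).
  move=> Sp; have U0 : Q p `^ b != 0 by rewrite gt_eqF// powR_gt0 ?Qpos.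
  by rewrite /V /t; field.
have V0 p : sphere R n p -> 0 < V p.
  move=> Sp; rewrite VE//; apply: mulr_gt0 => //.
  by apply: mulr_gt0; [rewrite powR_gt0 ?Qpos|exact: t0].
have V_pp : power_poly Q V.
  rewrite /V (_ : (fun p => _) = fun p => s * Q p `^ b + (s * w p) * Q p `^ 0).
    apply: power_polyD; apply: power_poly_mul; first exact: polynomialC.
    by apply: polynomialM => //; exact: polynomialC.
  by apply/funext => p; rewrite powRr0 mulr1.
pose L p := s * (N ^+ 2 / 4 * tau * Y p + conf_lap w p).
have w_d2 : twice_derivable_on (positive_locus Q) w.
  by case: pw => dw hw p _; exact: poly_lt_twice_derivable hw p I.
have U_d2 : twice_derivable_on (positive_locus Q) (fun p => Q p `^ b) :=
  @twice_derivable_bubble_power R n q a b.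
have oU := open_positive_locus pQ.
have LE p : sphere R n p -> conf_lap V p = L p.
  move=> Sp; rewrite /conf_lap (sublap_linear s s oU U_d2 w_d2 (Qpos p Sp)).
  have := bubble_equation Sq Sp (Qpos p Sp).
  rewrite a2 subKr /conf_lap -/b -/N -/Q -/(Y p) /L /V => <-.
  by rewrite /conf_lap; ring.
pose K p := V p `^ (- ((N + 2) / N)) * (2 * (N + 1) / N * L p).
have KE p : sphere R n p -> exists2 e', `|e'| <= eps / 8 &
    K p = (1 + t p) `^ (- ((N + 2) / N)) * (Rq + D p + e').
  move=> Sp; have Y0 : 0 < Y p by rewrite powR_gt0 ?Qpos.
  (* The error made in the linear equation, relative to L of the bubble. *)
  pose e' := (conf_lap w p - beta * (D p * Y p)) / (beta * Y p).
  have he' : `|e'| <= eps / 8.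
    rewrite normrM normfV (gtr0_norm (mulr_gt0 beta0 Y0)) (ler_pdivrMr _ _ (mulr_gt0 beta0 Y0)).
    apply: le_trans (w_eq p Sp) _; rewrite -mulrA.
    apply: ler_pM => //; first exact: ltW.
      by rewrite mulr_ge0// ltW.
    by rewrite (ler_pM2l beta0) Yy0.
  exists e' => //.
  have := power_scaling (t := t p) N0 C0 (Qpos p Sp) (t0 p Sp)
     (erefl b) (erefl s) (erefl (Q p `^ b)) (erefl (Y p)).
  rewrite -VE// /K /L => h.
  transitivity (s * V p `^ (- ((N + 2) / N)) *
     (2 * (N + 1) / N * (N ^+ 2 / 4 * tau * Y p + conf_lap w p))); first by ring.
  rewrite h (_ : N ^+ 2 / 4 * tau = beta * Rq); last first.
    by rewrite /beta divfK// gt_eqF.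
  rewrite /e' /C; field.
  by rewrite !gt_eqF// addr_gt0.
have K_cont p : sphere R n p -> {for p, continuous K}.
  move=> Sp; have V_cont : {for p, continuous V}.
    by have := power_poly_continuous pQ V_pp (Qpos p Sp); exact.
  apply: continuousM; first exact: continuous_powR_comp V_cont (V0 p Sp).
  apply: continuousM; first exact: cvg_cst.
  apply: continuousM; first exact: cvg_cst.
  apply: continuousD.
    by apply: continuousM; [exact: cvg_cst|exact: Y_cont].
  by case: pw => dw hw; exact: (poly_lt_continuous (poly_lt_conf_lap hw)).
have V_ext : smooth_extension V V.
  exists (positive_locus Q); split => //.
  exact: power_poly_smooth.
exists K; split.
- by apply: continuous_in_subspaceT => p pS; apply: K_cont; exact: set_mem.
- apply: (@le_lt_trans _ _ (3 / 4 * eps)%:E); last by rewrite lte_fin; lra.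
  apply: ge_ereal_sup => _ [p Sp <-]; rewrite lee_fin.
  have [e' he' ->] := KE p Sp.
  exact: (curvature_estimate eps_gt0 M_gt0 (hth _ (t_th p Sp)) (K0M p Sp) (K0R p) he').
exists V; split => //; first by exists V.
exists V => // p Sp.
have V_d2 := twice_derivable_linear s s oU U_d2 w_d2 (Qpos p Sp).
rewrite webster_scal_real ?LE//; first exact: V_d2.2.
move=> i j; rewrite !(partial_partial_linear s s oU U_d2 w_d2 _ _ (Qpos p Sp)).
case: pw => dw hw; rewrite (poly_lt_partialDC i j hw).
rewrite !partial_partial_bubble_power; try exact: Qpos.
by rewrite !partial_partial_bubble_base; ring.
Qed.
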